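(* Let $p,q$ be nonnegative integers, let $\kappa_1,\dots,\kappa_p,\mu_1,\dots,\mu_q$ be complex numbers none of which is in $\{0,-1,-2,\dots\}$, let $\alpha,\beta\in\mathbb{C}$ with $\Re(\alpha)>0$, let $\lambda_1,\lambda_2,\lambda_3\in\mathbb{C}$ with $\Re(\lambda_3)>\Re(\lambda_2)>0$, let $\rho\in\mathbb{C}$ with $\Re(\rho)>0$, and let $z\in\mathbb{C}$. Then the M-Gauss hypergeometric function satisfies $${}^{M}F_{p,q}^{(\alpha,\beta)}(\lambda_{1},\lambda_{2};\lambda_{3};z;\rho)=(1-z)^{-\lambda_{1}}\;{}^{M}F_{p,q}^{(\alpha,\beta)}\left( \lambda_{1},\lambda_{3}-\lambda_{2};\lambda_{3};\frac{z}{z-1};\rho\right).$$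
   Context: $(\lambda)_m=\Gamma(\lambda+m)/\Gamma(\lambda)$, $(\lambda)_0=1$ is the Pochhammer symbol and $B(x,y)=\int_0^1 t^{x-1}(1-t)^{y-1}dt$ is the classical beta function. The generalized M-series is $${}_{p}^{\alpha}M^{\beta}_{q}(\kappa_{1},\ldots,\kappa_{p};\mu_{1},\ldots,\mu_{q};z)=\sum_{m=0}^{\infty}\frac{(\kappa_{1})_{m}\cdots(\kappa_p)_{m}}{(\mu_1)_{m}\cdots(\mu_q)_{m}}\frac{z^{m}}{\Gamma(\alpha m+\beta)}.$$ With parameters $\kappa_1,\dots,\kappa_p;\mu_1,\dots,\mu_q$ suppressed from the notation, the modified beta (M-beta) and modified Gauss hypergeometric (M-Gauss hypergeometric) functions are $${}^{M}B_{p,q}^{(\alpha,\beta)}(x,y;\rho)=\int_{0}^{1}t^{x-1}(1-t)^{y-1}\,{}_{p}^{\alpha}M^{\beta}_{q}\left(\kappa_{1},\ldots,\kappa_{p};\mu_{1},\ldots,\mu_{q};\frac{-\rho}{t(1-t)}\right) dt,$$ $${}^{M}F_{p,q}^{(\alpha,\beta)}(\lambda_1,\lambda_2;\lambda_3;z;\rho)=\sum_{n=0}^{\infty}(\lambda_1)_{n}\frac{{}^{M}B_{p,q}^{(\alpha,\beta)}(\lambda_2+n,\lambda_3-\lambda_2;\rho)}{B(\lambda_2,\lambda_3-\lambda_2)}\frac{z^{n}}{n!}.$$ These functions are defined for those parameters and arguments for which the series and integrals converge. *)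

(* Defs.v *)
From HB Require Import structures.
From mathcomp Require Import all_boot all_order all_algebra.
From mathcomp Require Import complex ring.
From mathcomp Require Import all_classical all_reals all_analysis.

Set Implicit Arguments.
Unset Strict Implicit.
Unset Printing Implicit Defensive.

Import Order.TTheory GRing.Theory Num.Theory.
Import numFieldNormedType.Exports.

Local Open Scope classical_set_scope.
Local Open Scope ring_scope.
Local Open Scope complex_scope.

(* R[i] carries the topology of its modulus: `cvgn` and `limn` of complex     *)
(* sequences, and hence the sums of complex series, refer to it.             *)
HB.instance Definition _ (R : realType) :=
  PseudoMetricNormedZmod.copy R[i] (R[i] : numClosedFieldType)^o.

Definition cexp (R : realType) (z : R[i]) : R[i] :=
  (expR (complex.Re z))%:C * (cos (complex.Im z) +i* sin (complex.Im z)).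

Definition cmod (R : realType) (z : R[i]) : R :=
  Num.sqrt (complex.Re z ^+ 2 + complex.Im z ^+ 2).

(* Principal argument, with values in ]-pi, pi] for z != 0. *)
Definition carg (R : realType) (z : R[i]) : R :=
  let a := acos (complex.Re z / cmod z) in
  if 0 <= complex.Im z then a else - a.

Definition clog (R : realType) (z : R[i]) : R[i] := ln (cmod z) +i* carg z.

(* Principal value of z ^ w; only meaningful for z != 0. *)
Definition cpow (R : realType) (z w : R[i]) : R[i] := cexp (w * clog z).

(* Lebesgue integral of a complex-valued function of a real variable.        *)
Definition cintegrable (R : realType) (D : set R) (f : R -> R[i]) : Prop :=
  (@lebesgue_measure R).-integrable D (fun t => (complex.Re (f t))%:E) /\
  (@lebesgue_measure R).-integrable D (fun t => (complex.Im (f t))%:E).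

Definition cintegral (R : realType) (D : set R) (f : R -> R[i]) : R[i] :=
  Rintegral (@lebesgue_measure R) D (fun t => complex.Re (f t)) +i*
  Rintegral (@lebesgue_measure R) D (fun t => complex.Im (f t)).

(* Rising factorial: it equals Gamma (s + m) / Gamma s when s is not a pole   *)
(* of Gamma (see Gamma_shift) and is the usual value of the symbol when       *)
(* s = 0, -1, -2, ..., where that quotient is undefined.                     *)
Definition poch (R : realType) (s : R[i]) (m : nat) : R[i] :=
  \prod_(k < m) (s + k%:R).

(* Euler-Gauss limit n! n^s / (s (s + 1) ... (s + n)), which defines Gamma on *)
(* its whole domain.  At the poles s = 0, -1, -2, ... the sequence is         *)
(* eventually x / 0 = 0, so there Gamma s = 0 and (Gamma s)^-1 = 0, which is  *)
(* the value of the entire function 1 / Gamma.                               *)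
Definition Gamma_seq (R : realType) (s : R[i]) (n : nat) : R[i] :=
  n`!%:R * cpow n%:R s / poch s n.+1.

Definition Gamma (R : realType) (s : R[i]) : R[i] := limn (Gamma_seq s).

Lemma cexpD (R : realType) (z w : R[i]) : cexp (z + w) = cexp z * cexp w.
Proof.
case: z w => [a b] [c d]; rewrite /cexp /= expRD cosD sinD.
rewrite rmorphM /= mulrACA; congr (_ * _).
by rewrite /GRing.mul /=; congr (_ +i* _); rewrite addrC [X in X + _]mulrC.
Qed.

Lemma clog_nat (R : realType) (n : nat) :
  (0 < n)%N -> clog n%:R = (ln n%:R)%:C :> R[i].
Proof.
move=> n0; rewrite -(rmorph_nat (real_complex R)) /clog /carg /cmod /=.
rewrite lexx expr0n addr0 sqrtr_sqr ger0_norm ?ler0n// divff ?acos1 //.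
by rewrite pnatr_eq0 -lt0n.
Qed.

Lemma cpow_natS (R : realType) (n : nat) (s : R[i]) :
  (0 < n)%N -> cpow n%:R (s + 1) = n%:R * cpow n%:R s.
Proof.
move=> n0; rewrite /cpow mulrDl mul1r cexpD mulrC; congr (_ * _).
rewrite clog_nat// /cexp /= cos0 sin0 mulr1 lnK ?posrE ?ltr0n//.
exact: (rmorph_nat (real_complex R)).
Qed.

Lemma pochS (R : realType) (s : R[i]) (n : nat) :
  poch s n.+1 = s * poch (s + 1) n.
Proof.
rewrite /poch big_ord_recl addr0; congr (_ * _); apply: eq_bigr => i _.
by rewrite -addrA -natr1 [X in s + X]addrC.
Qed.

Lemma pochSr (R : realType) (s : R[i]) (n : nat) :
  poch s n.+1 = poch s n * (s + n%:R).
Proof. by rewrite /poch big_ord_recr. Qed.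

Lemma poch_neq0 (R : realType) (s : R[i]) (n : nat) :
  (forall k : nat, s != - k%:R) -> poch s n != 0.
Proof. by move=> hs; apply/prodf_neq0 => i _; rewrite addr_eq0. Qed.

Lemma Gamma_seqS (R : realType) (s : R[i]) (n : nat) :
  (forall k : nat, s != - k%:R) -> (0 < n)%N ->
  Gamma_seq (s + 1) n * (1 + (s + 1) / n%:R) = s * Gamma_seq s n.
Proof.
move=> hs n0; rewrite /Gamma_seq cpow_natS//.
have s0 : s != 0 by have := hs 0%N; rewrite oppr0.
have nz : n%:R != 0 :> R[i] by rewrite pnatr_eq0 -lt0n.
have hs1 (k : nat) : s + 1 != - k%:R.
  by rewrite -subr_eq0 opprK -addrA nat1r addr_eq0.
have h1 : s + 1 + n%:R != 0 by rewrite addr_eq0.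
have h2 := poch_neq0 n hs1.
rewrite pochSr pochS; set a := n`!%:R; set b := cpow _ _; set c := poch _ _ in h2 *.
set x := n%:R in nz h1 *.
have -> : 1 + (s + 1) / x = (s + 1 + x) / x.
  by rewrite [RHS]mulrDl divff// addrC.
by field; apply/and4P; split.
Qed.

Lemma cvg_Gamma_ratio (R : realType) (c : R[i]) :
  (fun n : nat => 1 + c / n%:R : R[i]) @ \oo --> (1 : R[i]).
Proof.
apply/(@cvgrPdist_lt R[i]) => e e0.
have [e' e'0 ee] : exists2 e' : R, 0 < e' & e = e'%:C.
  exists (complex.Re e); last first.
    move: e0; case: e => x y; rewrite ltcE/= => /andP[/eqP h _]. by rewrite h.
  by move: e0; case: e => x y; rewrite ltcE/= => /andP[].
near=> n.
rewrite opprD addrA subrr sub0r normrN normrM normfV normr_nat.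
have n0 : (0 < n)%N by near: n; exact: nbhs_infty_gt.
rewrite ltr_pdivrMr ?ltr0n// ee.
have -> : `|c| = (complex.Re `|c|)%:C by rewrite RRe_real ?normr_real.
rewrite -(rmorph_nat (real_complex R)) -rmorphM ltcR.
rewrite mulrC -ltr_pdivrMr//.
near: n; exact: nbhs_infty_gtr.
Unshelve. all: by end_near. Qed.

Lemma Gamma1 (R : realType) (s : R[i]) :
  (forall k : nat, s != - k%:R) -> Gamma (s + 1) = s * Gamma s.
Proof.
move=> hs.
have s0 : s != 0 by have := hs 0%N; rewrite oppr0.
have [cs|ncs] := pselect (cvgn (Gamma_seq s)); last first.
  have [cs1|ncs1] := pselect (cvgn (Gamma_seq (s + 1))).
    exfalso; apply: ncs; apply/cvg_ex; exists (s^-1 * (limn (Gamma_seq (s + 1)) * 1)).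
    have H := @cvgM R[i] _ _ eventually_filter _ _ _ _ (cs1 : _ --> _) (cvg_Gamma_ratio (s + 1)).
    have H2 := @cvgM R[i] _ _ eventually_filter _ _ _ _ (@cvg_cst R[i] s^-1 _ _ _) H.
    apply: cvg_trans (H2 _); apply: near_eq_cvg; near=> n.
    rewrite /GRing.mul_fun /=.
    rewrite Gamma_seqS ?mulKf//.
    by near: n; exact: nbhs_infty_gt.
  by rewrite /Gamma (dvgP ncs) (dvgP ncs1) mulr0.
rewrite [LHS]/Gamma; apply: cvg_lim; first by [].
have ratio0 : (1 : R[i]) != 0 by rewrite oner_eq0.
have H := @cvgM R[i] _ _ eventually_filter _ _ _ _
  (@cvgM R[i] _ _ eventually_filter _ _ _ _ (@cvg_cst R[i] s _ _ _) (cs : _ --> _))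
  (@cvgV R[i] _ _ eventually_filter _ _ ratio0 (cvg_Gamma_ratio (s + 1))).
rewrite invr1 mulr1 in H.
apply: cvg_trans (H _); apply: near_eq_cvg; near=> n.
have n0 : (0 < n)%N by near: n; exact: nbhs_infty_gt.
rewrite /GRing.mul_fun /= -Gamma_seqS// mulfK//.
have nz : n%:R != 0 :> R[i] by rewrite pnatr_eq0 -lt0n.
have -> : 1 + (s + 1) / n%:R = (s + n.+1%:R) / n%:R.
  by rewrite -[n.+1%:R]natr1; field.
by rewrite mulf_neq0 ?invr_eq0// addr_eq0.
Unshelve. all: by end_near. Qed.

Lemma Gamma_shift (R : realType) (s : R[i]) (m : nat) :
  (forall k : nat, s != - k%:R) -> Gamma (s + m%:R) = poch s m * Gamma s.
Proof.
move=> hs; elim: m => [|m IH]; first by rewrite addr0 /poch big_ord0 mul1r.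
rewrite -natr1 addrA Gamma1 => [|k].
  by rewrite IH pochSr mulrA (mulrC (poch _ _)).
by rewrite -subr_eq0 opprK -addrA -natrD addr_eq0.
Qed.

Definition Beta (R : realType) (x y : R[i]) : R[i] :=
  cintegral `]0, 1[%classic
    (fun t : R => cpow t%:C (x - 1) * cpow (1 - t)%:C (y - 1)).

Definition Mseries_term (R : realType) (p q : nat)
    (kappa : 'I_p -> R[i]) (mu : 'I_q -> R[i]) (alpha beta z : R[i])
    (m : nat) : R[i] :=
  (\prod_(i < p) poch (kappa i) m) / (\prod_(j < q) poch (mu j) m)
  * (z ^+ m / Gamma (alpha * m%:R + beta)).

Definition Mseries_converges (R : realType) (p q : nat)
    (kappa : 'I_p -> R[i]) (mu : 'I_q -> R[i]) (alpha beta z : R[i]) : Prop :=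
  cvgn (series (Mseries_term kappa mu alpha beta z)).

Definition Mseries (R : realType) (p q : nat)
    (kappa : 'I_p -> R[i]) (mu : 'I_q -> R[i]) (alpha beta z : R[i]) : R[i] :=
  limn (series (Mseries_term kappa mu alpha beta z)).

Definition MBeta_integrand (R : realType) (p q : nat)
    (kappa : 'I_p -> R[i]) (mu : 'I_q -> R[i]) (alpha beta x y rho : R[i])
    (t : R) : R[i] :=
  cpow t%:C (x - 1) * cpow (1 - t)%:C (y - 1)
  * Mseries kappa mu alpha beta (- rho / (t * (1 - t))%:C).

Definition MBeta_converges (R : realType) (p q : nat)
    (kappa : 'I_p -> R[i]) (mu : 'I_q -> R[i]) (alpha beta x y rho : R[i])
    : Prop :=
  (forall t : R, 0 < t < 1 ->
     Mseries_converges kappa mu alpha beta (- rho / (t * (1 - t))%:C)) /\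
  cintegrable `]0, 1[%classic (MBeta_integrand kappa mu alpha beta x y rho).

Definition MBeta (R : realType) (p q : nat)
    (kappa : 'I_p -> R[i]) (mu : 'I_q -> R[i]) (alpha beta x y rho : R[i])
    : R[i] :=
  cintegral `]0, 1[%classic (MBeta_integrand kappa mu alpha beta x y rho).

Definition MGauss_term (R : realType) (p q : nat)
    (kappa : 'I_p -> R[i]) (mu : 'I_q -> R[i])
    (alpha beta lambda1 lambda2 lambda3 z rho : R[i]) (n : nat) : R[i] :=
  poch lambda1 n
  * (MBeta kappa mu alpha beta (lambda2 + n%:R) (lambda3 - lambda2) rho
     / Beta lambda2 (lambda3 - lambda2))
  * (z ^+ n / n`!%:R).

Definition MGauss_converges (R : realType) (p q : nat)
    (kappa : 'I_p -> R[i]) (mu : 'I_q -> R[i])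
    (alpha beta lambda1 lambda2 lambda3 z rho : R[i]) : Prop :=
  (forall n : nat,
     MBeta_converges kappa mu alpha beta
       (lambda2 + n%:R) (lambda3 - lambda2) rho) /\
  cvgn (series
    (MGauss_term kappa mu alpha beta lambda1 lambda2 lambda3 z rho)).

Definition MGauss (R : realType) (p q : nat)
    (kappa : 'I_p -> R[i]) (mu : 'I_q -> R[i])
    (alpha beta lambda1 lambda2 lambda3 z rho : R[i]) : R[i] :=
  limn (series
    (MGauss_term kappa mu alpha beta lambda1 lambda2 lambda3 z rho)).

(* Main.v *)
Require Import Defs.
From mathcomp Require Import all_boot all_order all_algebra.
From mathcomp Require Import complex ring lra.
From mathcomp Require Import all_classical all_reals all_analysis.
From mathcomp Require Import measurable_realfun.

(** With f the integrand of the modified beta function at n = 0, the n-th terms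
    of the two series are c_n z^n \int t^n f and c_n w^n \int (1-t)^n f, where
    c_n = (lambda_1)_n / n! and w = z/(z-1).  Were summation and integration
    exchangeable, the identity
    (1 - t z)^(-lambda_1) = (1-z)^(-lambda_1) (1 - (1-t) w)^(-lambda_1),
    valid for principal powers when z is not in [1, +oo[, would give the claim.

    If lambda_1 is a nonpositive integer the sums are finite.  Otherwise the c_n
    decay subexponentially, so convergence at z forces the moments \int t^n f
    to be O(s^n) for every s > 1/|z|.  Testing f against 1 - exp(-(t/a)^n), an
    approximation of the indicator of t > a, shows that f is orthogonal to all
    polynomials on t > 1/|z|; likewise on 1 - t > 1/|w|.  Removing these parts
    one may assume |z| t <= 1 and |w| (1-t) <= 1.  For r < 1 dominated
    convergence then sums the series at r z, and the limit r -> 1 is taken by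
    Abel's theorem on the series side and by dominated convergence on the
    integral side.  For z real > 1 the remaining domain is at most a point. *)

Set Implicit Arguments.
Unset Strict Implicit.
Unset Printing Implicit Defensive.

Import Order.TTheory GRing.Theory Num.Theory.
Import numFieldNormedType.Exports.

Local Open Scope classical_set_scope.
Local Open Scope ring_scope.
Local Open Scope complex_scope.

Local Notation Re := complex.Re.
Local Notation Im := complex.Im.

(** * Complex numbers and their modulus *)

Lemma Re_add (R : realType) (x y : R[i]) : Re (x + y) = Re x + Re y.
Proof. by case: x y => [? ?] [? ?]. Qed.

Lemma Im_add (R : realType) (x y : R[i]) : Im (x + y) = Im x + Im y.
Proof. by case: x y => [? ?] [? ?]. Qed.

Lemma Re_opp (R : realType) (x : R[i]) : Re (- x) = - Re x.
Proof. by case: x. Qed.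

Lemma Im_opp (R : realType) (x : R[i]) : Im (- x) = - Im x.
Proof. by case: x. Qed.

Lemma Re_mul (R : realType) (x y : R[i]) :
  Re (x * y) = Re x * Re y - Im x * Im y.
Proof. by case: x y => [? ?] [? ?]. Qed.

Lemma Im_mul (R : realType) (x y : R[i]) :
  Im (x * y) = Re x * Im y + Im x * Re y.
Proof. by case: x y => [? ?] [? ?]. Qed.

Lemma Re_sum (R : realType) (I : Type) (s : seq I) (P : pred I) (F : I -> R[i]) :
  Re (\sum_(i <- s | P i) F i) = \sum_(i <- s | P i) Re (F i).
Proof. by apply: big_morph => // x y; rewrite Re_add. Qed.

Lemma Im_sum (R : realType) (I : Type) (s : seq I) (P : pred I) (F : I -> R[i]) :
  Im (\sum_(i <- s | P i) F i) = \sum_(i <- s | P i) Im (F i).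
Proof. by apply: big_morph => // x y; rewrite Im_add. Qed.

Lemma complexP (R : realType) (x y : R[i]) :
  Re x = Re y -> Im x = Im y -> x = y.
Proof. by case: x y => [? ?] [? ?] /= -> ->. Qed.

Lemma cmodE (R : realType) (z : R[i]) : (cmod z)%:C = `|z|.
Proof. by rewrite normc_def. Qed.

Lemma cmod_ge0 (R : realType) (z : R[i]) : 0 <= cmod z.
Proof. exact: sqrtr_ge0. Qed.

Lemma cmod_sqr (R : realType) (z : R[i]) : cmod z ^+ 2 = Re z ^+ 2 + Im z ^+ 2.
Proof. by rewrite sqr_sqrtr// addr_ge0// sqr_ge0. Qed.

Lemma cmodM (R : realType) (x y : R[i]) : cmod (x * y) = cmod x * cmod y.
Proof. by apply: complexI; rewrite rmorphM/= !cmodE normrM. Qed.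

Lemma cmodX (R : realType) (x : R[i]) n : cmod (x ^+ n) = cmod x ^+ n.
Proof. by apply: complexI; rewrite rmorphXn/= !cmodE normrX. Qed.

Lemma cmodV (R : realType) (x : R[i]) : cmod x^-1 = (cmod x)^-1.
Proof. by apply: complexI; rewrite fmorphV/= !cmodE normfV. Qed.

Lemma cmodN (R : realType) (x : R[i]) : cmod (- x) = cmod x.
Proof. by apply: complexI; rewrite !cmodE normrN. Qed.

Lemma cmod_real (R : realType) (x : R) : cmod x%:C = `|x|.
Proof. by rewrite /cmod /= expr0n addr0 sqrtr_sqr. Qed.

Lemma cmod0 (R : realType) : cmod (0 : R[i]) = 0.
Proof. by rewrite cmod_real normr0. Qed.

Lemma cmod1 (R : realType) : cmod (1 : R[i]) = 1.
Proof. by rewrite cmod_real normr1. Qed.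

Lemma cmod_nat (R : realType) n : cmod (n%:R : R[i]) = n%:R.
Proof. by rewrite -(rmorph_nat (real_complex R)) cmod_real normr_nat. Qed.

Lemma ler_cmodD (R : realType) (x y : R[i]) : cmod (x + y) <= cmod x + cmod y.
Proof. by rewrite -lecR rmorphD /= !cmodE ler_normD. Qed.

Lemma ler_cmodB (R : realType) (x y : R[i]) : cmod (x - y) <= cmod x + cmod y.
Proof. by rewrite (le_trans (ler_cmodD _ _))// cmodN. Qed.

Lemma lerB_cmod (R : realType) (x y : R[i]) : cmod x - cmod y <= cmod (x - y).
Proof. by rewrite lerBlDr -{1}(subrK y x) ler_cmodD. Qed.

Lemma cmod_eq0 (R : realType) (z : R[i]) : (cmod z == 0) = (z == 0).
Proof. by rewrite -[RHS]normr_eq0 -cmodE (inj_eq (@complexI R)). Qed.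

Lemma cmod_gt0 (R : realType) (z : R[i]) : (0 < cmod z) = (z != 0).
Proof. by rewrite lt_def cmod_eq0 cmod_ge0 andbT. Qed.

Lemma ler_cmod_sum (R : realType) (I : Type) (s : seq I) (P : pred I)
    (F : I -> R[i]) :
  cmod (\sum_(i <- s | P i) F i) <= \sum_(i <- s | P i) cmod (F i).
Proof.
rewrite -lecR cmodE (le_trans (ler_norm_sum _ _ _))// raddf_sum/= le_eqVlt.
by apply/orP; left; apply/eqP; apply: eq_bigr => i _; rewrite cmodE.
Qed.

Lemma ler_Re_cmod (R : realType) (z : R[i]) : `|Re z| <= cmod z.
Proof. by rewrite -sqrtr_sqr ler_sqrt ?addr_ge0 ?sqr_ge0// lerDl sqr_ge0. Qed.

Lemma ler_Im_cmod (R : realType) (z : R[i]) : `|Im z| <= cmod z.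
Proof. by rewrite -sqrtr_sqr ler_sqrt ?addr_ge0 ?sqr_ge0// lerDr sqr_ge0. Qed.

Lemma ler_cmod_ReIm (R : realType) (z : R[i]) : cmod z <= `|Re z| + `|Im z|.
Proof.
rewrite -(@ler_pXn2r R 2)// ?nnegrE ?cmod_ge0 ?addr_ge0// cmod_sqr.
rewrite -(real_normK (num_real (Re z))) -(real_normK (num_real (Im z))).
rewrite sqrrD lerD2r lerDl mulrn_wge0// mulr_ge0//.
Qed.

Lemma cvg_complexP (R : realType) (u : nat -> R[i]) (l : R[i]) :
  (u @ \oo --> l) <->
  ((fun n => Re (u n)) @ \oo --> Re l /\ (fun n => Im (u n)) @ \oo --> Im l).
Proof.
split => [/(@cvgrPdist_lt R[i]) ul|[ur ui]].
  split; apply/cvgrPdist_lt => e e0.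
    have /ul : 0 < e%:C by rewrite ltcR.
    apply: filterS => n; rewrite -cmodE ltcR; apply: le_lt_trans.
    by rewrite -Re_opp -Re_add ler_Re_cmod.
  have /ul : 0 < e%:C by rewrite ltcR.
  apply: filterS => n; rewrite -cmodE ltcR; apply: le_lt_trans.
  by rewrite -Im_opp -Im_add ler_Im_cmod.
apply/(@cvgrPdist_lt R[i]) => e.
(* In the order of [R[i]], [0 < e] forces [Im e = 0], so the tolerance may be taken real. *)
rewrite ltcE /= => /andP[/eqP ei e0].
have {ei} -> : e = (Re e)%:C by apply: complexP.
move: (Re e) e0 => {}e e0.
move/cvgrPdist_lt : ur => /(_ (e / 2)); rewrite divr_gt0// => /(_ isT) ur.
move/cvgrPdist_lt : ui => /(_ (e / 2)); rewrite divr_gt0// => /(_ isT) ui.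
apply: filterS2 ur ui => n h1 h2; rewrite -cmodE ltcR.
apply: (le_lt_trans (ler_cmod_ReIm _)).
by rewrite !Re_add !Im_add !Re_opp !Im_opp [ltRHS]splitr ltrD.
Qed.

Lemma cvg_cmod (R : realType) (u : nat -> R[i]) (l : R[i]) (v : nat -> R) :
  (forall n, cmod (u n - l) <= v n) -> v @ \oo --> 0 -> u @ \oo --> l.
Proof.
move=> uv v0.
have H (f : R[i] -> R) (fB : forall x y, f (x - y) = f x - f y)
    (fm : forall x, `|f x| <= cmod x) : (fun n => f (u n)) @ \oo --> f l.
  apply/cvgrPdist_le => e e0; move/cvgrPdist_le : v0 => /(_ _ e0).
  apply: filterS => n; rewrite sub0r normrN; apply: le_trans.
  rewrite distrC -fB (le_trans (fm _))// (le_trans (uv _))// ler_norm//.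
apply/cvg_complexP; split; apply: H => x *.
- by rewrite Re_add Re_opp.
- exact: ler_Re_cmod.
- by rewrite Im_add Im_opp.
- exact: ler_Im_cmod.
Qed.

(** * Complex-valued functions of a real variable *)

(** Only derivatives along a real parameter occur, so they are taken componentwise and real calculus
    applies; no holomorphy is involved. *)
Definition is_cderive (R : realType) (f : R -> R[i]) (t : R) (d : R[i]) :=
  is_derive t 1 (fun s => Re (f s) : R^o) (Re d) /\
  is_derive t 1 (fun s => Im (f s) : R^o) (Im d).

Lemma is_cderive_eq (R : realType) (f : R -> R[i]) t d d' :
  is_cderive f t d -> d = d' -> is_cderive f t d'.
Proof. by move=> ? <-. Qed.

Lemma is_cderive_line (R : realType) (a b : R[i]) t :
  is_cderive (fun s : R => a + s%:C * b) t b.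
Proof.
split.
- have -> : (fun s : R => Re (a + s%:C * b) : R^o) = (fun s => Re a + s * Re b).
    by apply/funext => s; rewrite Re_add Re_mul/= mul0r subr0.
  apply: is_derive_eq; rewrite /GRing.scale/=; ring.
- have -> : (fun s : R => Im (a + s%:C * b) : R^o) = (fun s => Im a + s * Im b).
    by apply/funext => s; rewrite Im_add Im_mul/= mul0r addr0.
  apply: is_derive_eq; rewrite /GRing.scale/=; ring.
Qed.

Lemma is_cderive_cst (R : realType) (a : R[i]) t :
  is_cderive (fun _ : R => a) t 0.
Proof. by split; apply: is_derive_cst. Qed.

Lemma is_cderiveD (R : realType) (f g : R -> R[i]) t df dg :
  is_cderive f t df -> is_cderive g t dg ->
  is_cderive (fun s => f s + g s) t (df + dg).
Proof.
move=> [f1 f2] [g1 g2]; split.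
- rewrite Re_add (_ : (fun s => _) = (fun s => Re (f s)) \+ (fun s => Re (g s))).
    exact: is_deriveD.
  by apply/funext => s; rewrite Re_add.
- rewrite Im_add (_ : (fun s => _) = (fun s => Im (f s)) \+ (fun s => Im (g s))).
    exact: is_deriveD.
  by apply/funext => s; rewrite Im_add.
Qed.

Lemma is_cderiveN (R : realType) (f : R -> R[i]) t df :
  is_cderive f t df -> is_cderive (fun s => - f s) t (- df).
Proof.
move=> [f1 f2]; split.
- rewrite Re_opp (_ : (fun s => _) = \- (fun s => Re (f s))).
    exact: is_deriveN.
  by apply/funext => s; rewrite Re_opp.
- rewrite Im_opp (_ : (fun s => _) = \- (fun s => Im (f s))).
    exact: is_deriveN.
  by apply/funext => s; rewrite Im_opp.
Qed.

Lemma is_cderiveM (R : realType) (f g : R -> R[i]) t df dg :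
  is_cderive f t df -> is_cderive g t dg ->
  is_cderive (fun s => f s * g s) t (f t * dg + df * g t).
Proof.
move=> [f1 f2] [g1 g2]; split.
- rewrite (_ : (fun s => _) = ((fun s => Re (f s)) \* (fun s => Re (g s))) \-
     ((fun s => Im (f s)) \* (fun s => Im (g s)))); last first.
    by apply/funext => s; rewrite Re_mul.
  apply: is_derive_eq; rewrite Re_add !Re_mul /GRing.scale/=; ring.
- rewrite (_ : (fun s => _) = ((fun s => Re (f s)) \* (fun s => Im (g s))) \+
     ((fun s => Im (f s)) \* (fun s => Re (g s)))); last first.
    by apply/funext => s; rewrite Im_mul.
  apply: is_derive_eq; rewrite Im_add !Im_mul /GRing.scale/=; ring.
Qed.

Lemma is_cderive_cexp (R : realType) (f : R -> R[i]) t df :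
  is_cderive f t df -> is_cderive (fun s => cexp (f s)) t (cexp (f t) * df).
Proof.
move=> [f1 f2].
pose E (s : R) := expR (Re (f s)).
have dE : is_derive t 1 (E : R -> R^o) (expR (Re (f t)) * Re df).
  exact: (is_derive1_comp (is_derive_expR _) f1).
have dC : is_derive t 1 (fun s => cos (Im (f s)) : R^o)
    (- sin (Im (f t)) * Im df).
  exact: (is_derive1_comp (is_derive_cos _) f2).
have dS : is_derive t 1 (fun s => sin (Im (f s)) : R^o)
    (cos (Im (f t)) * Im df).
  exact: (is_derive1_comp (is_derive_sin _) f2).
split.
- rewrite (_ : (fun s => _) = E \* (fun s => cos (Im (f s)))); last first.
    by apply/funext => s; rewrite /cexp Re_mul/= mul0r subr0.
  apply: is_derive_eq; rewrite /cexp Re_mul Re_mul Im_mul /E/= /GRing.scale/=; ring.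
- rewrite (_ : (fun s => _) = E \* (fun s => sin (Im (f s)))); last first.
    by apply/funext => s; rewrite /cexp Im_mul/= mul0r addr0.
  apply: is_derive_eq; rewrite /cexp Im_mul Re_mul Im_mul /E/= /GRing.scale/=; ring.
Qed.

(** The mean value theorem fails for complex values; it is applied to the real and imaginary parts
    separately, whence the factor 2. *)
Lemma ler_cmod_increment (R : realType) (f df : R -> R[i]) (a b B : R) :
  a <= b -> (forall t, a <= t <= b -> is_cderive f t (df t)) ->
  (forall t, a <= t <= b -> cmod (df t) <= B) ->
  cmod (f b - f a) <= 2 * (B * (b - a)).
Proof.
move=> ab fdf dfB.
have H (g dg : R -> R) :
    (forall t : R, a <= t <= b -> is_derive t 1 (g : R -> R^o) (dg t)) ->
    (forall t : R, a <= t <= b -> `|dg t| <= B) -> `|g b - g a| <= B * (b - a).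
  move=> gdg dgB.
  have [x||c c01 ->] := @MVT_segment R g dg a b ab.
  - rewrite in_itv/= => /andP[x0 x1]; apply: gdg.
    by rewrite (ltW x0) (ltW x1).
  - apply: derivable_within_continuous => x; rewrite in_itv/= => x01.
    exact: (@ex_derive _ _ _ _ _ _ _ (gdg _ x01)).
  - rewrite normrM (ger0_norm (_ : 0 <= b - a)) ?subr_ge0//.
    rewrite ler_wpM2r ?subr_ge0//; apply: dgB.
    by move: c01; rewrite in_itv.
apply: (le_trans (ler_cmod_ReIm _)); rewrite mulr_natl mulr2n.
rewrite Re_add Im_add Re_opp Im_opp; apply: lerD.
- apply: (H (fun t => Re (f t)) (fun t => Re (df t))) => t tab.
    by have [] := fdf _ tab.
  by rewrite (le_trans (ler_Re_cmod _)) ?dfB.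
- apply: (H (fun t => Im (f t)) (fun t => Im (df t))) => t tab.
    by have [] := fdf _ tab.
  by rewrite (le_trans (ler_Im_cmod _)) ?dfB.
Qed.

Lemma is_cderive_cvg (R : realType) (f : R -> R[i]) t d (u : nat -> R) :
  is_cderive f t d -> u @ \oo --> t -> (fun n => f (u n)) @ \oo --> f t.
Proof.
move=> [f1 f2] ut.
have H (g : R -> R) dg : is_derive t 1 (g : R -> R^o) dg ->
    (fun n => g (u n)) @ \oo --> g t.
  move=> [dg1 _]; have gt : {for t, continuous (g : R -> R^o)}.
    exact/differentiable_continuous/derivable1_diffP.
  exact: (cvg_comp _ _ ut gt).
apply/cvg_complexP; split.
- exact: (H (fun s => Re (f s)) _ f1).
- exact: (H (fun s => Im (f s)) _ f2).
Qed.

(** * The principal logarithm off the negative half-line *)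

(** The plane cut along ]-oo, 0], on which the principal logarithm is smooth. *)
Definition slit (R : realType) (z : R[i]) := (Im z != 0) || (0 < Re z).

Lemma slit_neq0 (R : realType) (z : R[i]) : slit z -> z != 0.
Proof. by apply: contraL => /eqP ->; rewrite /slit /= eqxx ltxx. Qed.

Lemma slit_gt0 (R : realType) (z : R[i]) : slit z -> 0 < cmod z + Re z.
Proof.
move=> zs; case/orP: (zs) => [z0|z0]; last by rewrite ltr_wpDl// cmod_ge0.
have : `|Re z| < cmod z.
  rewrite -(@ltr_pXn2r R 2)// ?nnegrE ?cmod_ge0// cmod_sqr real_normK ?num_real//.
  by rewrite ltrDl lt_def sqr_ge0 sqrf_eq0 z0.
by rewrite ltr_norml => /andP[h _]; rewrite -ltrBlDl sub0r.
Qed.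

(** Half-angle formula: the tangent of half the argument is Im z / (|z| + Re z). Unlike the
    definition by [acos] with a case on the sign, it is one differentiable expression on the whole
    slit plane. *)
Lemma carg_atan (R : realType) (z : R[i]) : slit z ->
  carg z = 2 * atan (Im z / (cmod z + Re z)).
Proof.
move=> zs; have zx := slit_gt0 zs.
have zm : 0 < cmod z by rewrite cmod_gt0 slit_neq0.
set w := Im z / _.
have w2 : 1 + w ^+ 2 = 2 * cmod z / (cmod z + Re z).
  have e := cmod_sqr z.
  rewrite /w expr_div_n (_ : Im z ^+ 2 = cmod z ^+ 2 - Re z ^+ 2); last first.
    by rewrite e addrC addKr.
  by field; rewrite gt_eqF.
have cosE : cos (2 * atan w) = Re z / cmod z.
  rewrite mulr_natl cos_mulr2n cos_atan exprVn sqr_sqrtr ?w2; last first.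
    by rewrite divr_ge0// ?mulr_ge0// ltW.
  by rewrite -mulr_natl; field; rewrite !gt_eqF.
rewrite /carg -cosE; case: ifPn => z0.
- rewrite cosK// in_itv/=; apply/andP; split.
    by rewrite mulr_ge0// -atan0 le_atan// divr_ge0// ltW.
  by rewrite mulrC -ler_pdivlMr// ltW// atan_ltpi2.
- rewrite cosKN ?opprK//; apply/andP; split.
    by rewrite mulrC -ler_pdivrMr// mulNr ltW// atan_gtNpi2.
  rewrite pmulr_rle0// -atan0 le_atan// mulr_le0_ge0// ?invr_ge0 ltW//.
  by rewrite ltNge.
Qed.

Lemma norm_carg_le_pi (R : realType) (z : R[i]) : z != 0 -> `|carg z| <= pi.
Proof.
move=> z0.
have h : -1 <= Re z / cmod z <= 1.
  rewrite -ler_norml normrM normfV (ger0_norm (cmod_ge0 z)).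
  by rewrite ler_pdivrMr ?cmod_gt0// mul1r ler_Re_cmod.
rewrite /carg; have -> : forall (b : bool) (x : R), `|if b then x else - x| = `|x|.
  by case=> x //; rewrite normrN.
by rewrite ger0_norm ?acos_ge0// acos_lepi.
Qed.

Lemma cexp_clog (R : realType) (z : R[i]) : z != 0 -> cexp (clog z) = z.
Proof.
move=> z0; have zm : 0 < cmod z by rewrite cmod_gt0.
have h : -1 <= Re z / cmod z <= 1.
  rewrite -ler_norml normrM normfV (ger0_norm (cmod_ge0 z)).
  by rewrite ler_pdivrMr// mul1r ler_Re_cmod.
have cosE : cos (carg z) = Re z / cmod z.
  by rewrite /carg; case: ifP => _; rewrite ?cosN acosK// in_itv.
have sinE : sin (carg z) = Im z / cmod z.
  (* [acos] takes values in [0, pi], where the sine is nonnegative, so it yields [|Im z| / cmod z];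
     the sign chosen in [carg] restores that of [Im z]. *)
  have -> : sin (carg z) = (if 0 <= Im z then 1 else -1) * (`|Im z| / cmod z).
    have e : sin (acos (Re z / cmod z)) = `|Im z| / cmod z.
      rewrite sin_acos// expr_div_n -[1](divff (lt0r_neq0 (exprn_gt0 2 zm))).
      rewrite -mulrBl cmod_sqr addrC addKr -cmod_sqr -expr_div_n sqrtr_sqr.
      by rewrite normrM normfV (ger0_norm (ltW zm)).
    by rewrite /carg; case: ifP => _; rewrite ?sinN e ?mul1r ?mulN1r.
  case: ifPn => i0; first by rewrite ger0_norm// mul1r.
  by rewrite mulN1r ltr0_norm ?ltNge// mulNr opprK.
rewrite /cexp /clog /= lnK ?posrE// cosE sinE.
apply: complexP; rewrite ?Re_mul ?Im_mul/= mul0r ?subr0 ?addr0 mulrC divfK//;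
  by rewrite gt_eqF.
Qed.

Lemma slit_near (R : realType) (f : R -> R[i]) (t : R) df :
  is_cderive f t df -> slit (f t) -> \forall s \near t, slit (f s).
Proof.
move=> [[f1 _] [f2 _]].
have c1 : {for t, continuous (fun s => Re (f s) : R^o)}.
  exact/differentiable_continuous/derivable1_diffP.
have c2 : {for t, continuous (fun s => Im (f s) : R^o)}.
  exact/differentiable_continuous/derivable1_diffP.
case/orP => h.
- have : \forall s \near t, Im (f s) != 0 by apply: (cvgr_neq0 _ c2).
  by apply: filterS => s hs; apply/orP; left.
- have : \forall s \near t, 0 < Re (f s) by apply: (cvgr_gt _ c1).
  by apply: filterS => s hs; apply/orP; right.
Qed.

Lemma is_cderive_clog (R : realType) (f : R -> R[i]) t df :
  is_cderive f t df -> slit (f t) ->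
  is_cderive (fun s => clog (f s)) t (df / f t).
Proof.
move=> fd fs; have [f1 f2] := fd.
have fx := slit_gt0 fs.
have fm : 0 < cmod (f t) by rewrite cmod_gt0 slit_neq0.
have fe := cmod_sqr (f t).
have dm : is_derive t 1 (fun s => cmod (f s) : R^o)
    ((Re (f t) * Re df + Im (f t) * Im df) / cmod (f t)).
  have h : is_derive t 1 (fun s => Re (f s) ^+ 2 + Im (f s) ^+ 2 : R^o)
      (2 * (Re (f t) * Re df + Im (f t) * Im df)).
    rewrite (_ : (fun s => _) = ((fun s => Re (f s)) \* (fun s => Re (f s))) \+
      ((fun s => Im (f s)) \* (fun s => Im (f s)))).
      by apply: is_derive_eq; rewrite /GRing.scale/=; ring.
    by apply/funext => s; rewrite !expr2.
  have p : 0 < Re (f t) ^+ 2 + Im (f t) ^+ 2 by rewrite -fe exprn_gt0.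
  have := @is_derive1_comp R Num.sqrt
    (fun s => Re (f s) ^+ 2 + Im (f s) ^+ 2) t _ _ (is_derive1_sqrt p) h.
  move=> k; apply: (is_derive_eq k); rewrite -/(cmod (f t)).
  by field; rewrite gt_eqF.
(* The inverse is the conjugate divided by the squared modulus, which makes the real and imaginary
   parts of [df / f t] explicit. *)
have fi : (f t)^-1 = ((cmod (f t))^-2)%:C * (Re (f t) -i* Im (f t)).
  apply: (mulfI (slit_neq0 fs)); rewrite divff ?slit_neq0//.
  apply: complexP; rewrite !(Re_mul, Im_mul)/= !(mul0r, subr0, addr0).
    by rewrite fe; field; rewrite -fe expf_neq0// gt_eqF.
  by rewrite fe; field; rewrite -fe expf_neq0// gt_eqF.
split.
- have := @is_derive1_comp R (@ln R) (fun s => cmod (f s)) t _ _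
    (is_derive1_ln fm) dm.
  move=> k; apply: (is_derive_eq k); rewrite fi Re_mul Re_mul Im_mul/=.
  by field; rewrite gt_eqF.
(* The slit plane is open, so the half-angle formula for the argument holds in a neighbourhood of
   [t] and may be differentiated there. *)
- apply: (@near_eq_is_derive _ _ _
    (fun s => 2 * atan (Im (f s) / (cmod (f s) + Re (f s))))).
    by have := slit_near fd fs; apply: filterS => s; move/carg_atan.
  have dw : is_derive t 1 (fun s => cmod (f s) + Re (f s) : R^o)
     ((Re (f t) * Re df + Im (f t) * Im df) / cmod (f t) + Re df).
    rewrite (_ : (fun s => _) = (fun s => cmod (f s)) \+ (fun s => Re (f s))) //.
    exact: is_deriveD.
  have fx0 : cmod (f t) + Re (f t) != 0 by rewrite gt_eqF.
  have dV := @is_deriveV R (fun s => cmod (f s) + Re (f s)) t _ 1 fx0 dw.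
  have dq : is_derive t 1 (fun s => Im (f s) / (cmod (f s) + Re (f s)) : R^o)
    (Im (f t) * (- (cmod (f t) + Re (f t)) ^- 2 *
       ((Re (f t) * Re df + Im (f t) * Im df) / cmod (f t) + Re df))
       + (cmod (f t) + Re (f t))^-1 * Im df).
    rewrite (_ : (fun s => _) =
      (fun s => Im (f s)) \* (fun s => (cmod (f s) + Re (f s))^-1)) //.
    exact: is_derive_eq.
  have := @is_derive1_comp R atan
    (fun s => Im (f s) / (cmod (f s) + Re (f s))) t _ _
    (is_derive1_atan _) dq.
  move=> k; have {}k := is_deriveZ 2 k; apply: (is_derive_eq k).
  rewrite /GRing.scale/= fi Im_mul Re_mul Im_mul /=.
  have [rx0 m0] := (lt0r_neq0 fx, lt0r_neq0 fm).
  move: (cmod (f t)) (Re (f t)) (Im (f t)) (Re df) (Im df) fe rx0 m0 => m x y x' y' e rx0 m0.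
  have y2 : y ^+ 2 = m ^+ 2 - x ^+ 2 by rewrite e addrC addKr.
  have -> : 1 + (y / (m + x)) ^+ 2 = 2 * m / (m + x).
    by rewrite expr_div_n y2; field.
  transitivity ((y' * (m + x) * m - y * x * x' - y ^+ 2 * y' - y * x' * m)
    / (m ^+ 2 * (m + x))); first by field; rewrite rx0 m0.
  by rewrite y2; field; rewrite rx0 m0.
Qed.

(** * The binomial series *)

Lemma cmod_cexp (R : realType) (w : R[i]) : cmod (cexp w) = expR (Re w).
Proof.
rewrite /cexp cmodM cmod_real ger0_norm ?expR_ge0// /cmod/= cos2Dsin2.
by rewrite sqrtr1 mulr1.
Qed.

Lemma cexp0 (R : realType) : cexp (0 : R[i]) = 1.
Proof. by rewrite /cexp/= expR0 cos0 sin0 mul1r. Qed.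

Lemma clog1 (R : realType) : clog (1 : R[i]) = 0.
Proof. by rewrite -[1]/(1%:R) clog_nat// ln1. Qed.

(** |v^w| is exp(Re(w log v)), at most exp(|w| |log v|), and |log v| is at most |ln |v|| + pi. The
    bound is uniform on an annulus, as dominated convergence requires. *)
Lemma ler_cmod_cpow (R : realType) (v w : R[i]) (a b : R) :
  0 < a -> a <= cmod v <= b ->
  cmod (cpow v w) <= expR (cmod w * (`|ln a| + `|ln b| + pi)).
Proof.
move=> a0 /andP[av vb]; have v0 : 0 < cmod v by rewrite (lt_le_trans a0).
rewrite /cpow cmod_cexp ler_expR (le_trans (ler_norm _))//.
rewrite (le_trans (ler_Re_cmod _))// cmodM ler_wpM2l ?cmod_ge0//.
rewrite (le_trans (ler_cmod_ReIm _))//= lerD ?norm_carg_le_pi -?cmod_gt0//.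
have h1 : ln a <= ln (cmod v) by rewrite ler_ln ?posrE.
have h2 : ln (cmod v) <= ln b by rewrite ler_ln ?posrE// (lt_le_trans v0).
rewrite ler_norml; apply/andP; split.
  by rewrite (le_trans _ h1)// lerNl (le_trans (ler_norm _))// normrN lerDl.
by rewrite (le_trans h2)// (le_trans (ler_norm _))// lerDr.
Qed.

(** For nonnegative [a] this says that the n-th roots of [a n] have upper limit at most 1. *)
Definition subexp (R : realType) (a : nat -> R) :=
  forall q, 0 < q < 1 -> exists2 C, 0 <= C & forall n, a n * q ^+ n <= C.

(** Once [b n < q^-1], the products [a n * q ^+ n] no longer increase; the sum of the terms up to
    that rank therefore bounds all of them. *)
Lemma subexp_ratio (R : realType) (a b : nat -> R) :
  (forall n, 0 <= a n) -> (forall n, a n.+1 <= b n * a n) ->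
  b @ \oo --> (1 : R) -> subexp a.
Proof.
move=> a0 ab b1 q /andP[q0 q1].
have [N _ Nb] : \forall n \near \oo, b n < q^-1.
  by apply: (cvgr_lt _ b1); rewrite invf_gt1.
have aq0 n : 0 <= a n * q ^+ n by rewrite mulr_ge0// exprn_ge0// ltW.
exists (\sum_(n < N.+1) a n * q ^+ n); first by rewrite sumr_ge0.
have H n : (n < N.+1)%N -> a n * q ^+ n <= \sum_(n < N.+1) a n * q ^+ n.
  by move=> nN; rewrite (bigD1 (Ordinal nN))//= lerDl sumr_ge0.
elim=> [|n IH]; first exact: H.
case: (ltnP n.+1 N.+1) => [/H//|nN].
apply: le_trans IH; rewrite exprS mulrA ler_wpM2r ?exprn_ge0 ?(ltW q0)//.
rewrite -ler_pdivlMr// (le_trans (ab _))// mulrC ler_wpM2l// ltW//.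
exact: Nb.
Qed.

(** The midpoint of q and 1 is used in [subexp]; the ratio of q to this midpoint is the geometric
    rate. *)
Lemma subexp_geo (R : realType) (a : nat -> R) (q : R) :
  subexp a -> 0 <= q < 1 ->
  exists C r, [/\ 0 <= C, 0 <= r, r < 1 & forall n, a n * q ^+ n <= C * r ^+ n].
Proof.
move=> sa /andP[q0 q1].
have p0 : 0 < (1 + q) / 2 by lra.
have [|C C0 CP] := sa ((1 + q) / 2); first by rewrite p0/=; lra.
exists C, (q / ((1 + q) / 2)); split => //.
- by rewrite divr_ge0// ltW.
- by rewrite ltr_pdivrMr//; lra.
move=> n; rewrite -[in leLHS](divfK (lt0r_neq0 p0) q) exprMn mulrA mulrAC.
by rewrite ler_wpM2r// exprn_ge0// divr_ge0// ltW.
Qed.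

Lemma geo_partial_sum (R : realType) (r : R) N :
  0 <= r < 1 -> \sum_(n < N) r ^+ n <= (1 - r)^-1.
Proof.
move=> /andP[r0 r1]; rewrite -[leRHS]mul1r ler_pdivlMr ?subr_gt0//.
have -> : (\sum_(n < N) r ^+ n) * (1 - r) = 1 - r ^+ N.
  by rewrite -[RHS]opprB subrX1 -mulNr opprB mulrC.
by rewrite lerBlDr lerDl exprn_ge0.
Qed.

Lemma subexp_sum (R : realType) (a : nat -> R) (q : R) :
  subexp a -> 0 <= q < 1 ->
  exists2 B, 0 <= B & forall N, \sum_(n < N) a n * q ^+ n <= B.
Proof.
move=> sa q01; have [C [r [C0 r0 r1 CP]]] := subexp_geo sa q01.
exists (C / (1 - r)) => [|N]; first by rewrite divr_ge0// subr_ge0 ltW.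
apply: (@le_trans _ _ (\sum_(n < N) C * r ^+ n)); first exact: ler_sum.
by rewrite -mulr_sumr ler_wpM2l// geo_partial_sum// r0.
Qed.

Lemma subexp_cvg0 (R : realType) (a : nat -> R) (q : R) :
  (forall n, 0 <= a n) -> subexp a -> 0 <= q < 1 ->
  (fun n => a n * q ^+ n) @ \oo --> 0.
Proof.
move=> a0 sa q01; have [C [r [C0 r0 r1 CP]]] := subexp_geo sa q01.
have q0 : 0 <= q by case/andP: q01.
apply: (@squeeze_cvgr _ _ _ _ (fun=> 0) (fun n => C * r ^+ n)).
- by apply: nearW => n; rewrite CP mulr_ge0// exprn_ge0.
- exact: cvg_cst.
- rewrite -[X in _ --> X](mulr0 C); apply: cvgMr; apply: cvg_expr.
  by rewrite ger0_norm.
Qed.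

(** The coefficient of u^n in the expansion of (1 - u)^(-l). *)
Definition bcoef (R : realType) (l : R[i]) n : R[i] := poch l n / n`!%:R.

Lemma bcoefS (R : realType) (l : R[i]) n :
  bcoef l n.+1 * n.+1%:R = bcoef l n * (l + n%:R).
Proof.
have f0 : n`!%:R != 0 :> R[i] by rewrite pnatr_eq0 -lt0n fact_gt0.
have n0 : n.+1%:R != 0 :> R[i] by rewrite pnatr_eq0.
by rewrite /bcoef pochSr factS natrM invfM mulrA mulrAC divfK// mulrAC.
Qed.

Lemma bcoefSl (R : realType) (l : R[i]) n :
  bcoef l n.+1 * n.+1%:R = l * bcoef (l + 1) n.
Proof.
have n0 : n.+1%:R != 0 :> R[i] by rewrite pnatr_eq0.
by rewrite /bcoef pochS factS natrM invfM [in LHS]mulrA [LHS]mulrAC divfK// mulrA.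
Qed.

Lemma bcoef0 (R : realType) (l : R[i]) : bcoef l 0 = 1.
Proof. by rewrite /bcoef /poch big_ord0 divr1. Qed.

Lemma bcoef_ratio_cvg (R : realType) (l : R[i]) :
  (fun n => cmod (l + n%:R) / n.+1%:R) @ \oo --> (1 : R).
Proof.
apply/cvgrPdist_le => e e0.
near=> n.
have n0 : 0 < n.+1%:R :> R by rewrite ltr0n.
have -> : 1 - cmod (l + n%:R) / n.+1%:R = (n.+1%:R - cmod (l + n%:R)) / n.+1%:R.
  by rewrite mulrBl divff// gt_eqF.
rewrite normrM normfV (gtr0_norm n0) ler_pdivrMr//.
(* |l + n| and n + 1 differ by at most |l - 1|, uniformly in n. *)
apply: (@le_trans _ _ (cmod (l - 1))).
  have n1 := cmod_nat R n.+1.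
  have -> : l - 1 = (l + n%:R) - n.+1%:R by rewrite -natr1; ring.
  rewrite ler_norml; apply/andP; split; rewrite -{1}n1.
    by rewrite lerNl opprB lerB_cmod.
  by rewrite -[leRHS]cmodN opprB lerB_cmod.
rewrite -ler_pdivrMl// (@le_trans _ _ n%:R)// ?ler_nat//.
near: n; exact: nbhs_infty_ger.
Unshelve. all: by end_near. Qed.

Lemma cmod_bcoefS (R : realType) (l : R[i]) n :
  cmod (bcoef l n.+1) = cmod (l + n%:R) / n.+1%:R * cmod (bcoef l n).
Proof.
have n0 : n.+1%:R != 0 :> R by rewrite pnatr_eq0.
apply: (mulIf n0); rewrite -{1}(cmod_nat R n.+1) -cmodM bcoefS cmodM.
by rewrite [RHS]mulrAC divfK// mulrC.
Qed.

Lemma subexp_bcoef (R : realType) (l : R[i]) :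
  subexp (fun n => cmod (bcoef l n)).
Proof.
apply: (@subexp_ratio _ _ (fun n => cmod (l + n%:R) / n.+1%:R)).
- by move=> n; exact: cmod_ge0.
- by move=> n; rewrite cmod_bcoefS.
- exact: bcoef_ratio_cvg.
Qed.

(** The successive ratios of the coefficients tend to 1, hence so do their inverses: the
    coefficients decay no faster than subexponentially. *)
Lemma subexp_bcoefV (R : realType) (l : R[i]) :
  (forall n : nat, l != - n%:R) -> subexp (fun n => (cmod (bcoef l n))^-1).
Proof.
move=> ln; apply: (@subexp_ratio _ _ (fun n => (cmod (l + n%:R) / n.+1%:R)^-1)).
- by move=> n; rewrite invr_ge0 cmod_ge0.
- by move=> n; rewrite cmod_bcoefS invfM.
- by rewrite -[X in _ --> X]invr1; apply: cvgV; [exact: oner_neq0|exact: bcoef_ratio_cvg].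
Qed.


(** The function y(s) = (1 - s u)^(-l) solves (1 - s u) y' = l u y; the truncated series satisfies
    this equation up to one remainder term. *)
Lemma binomial_ode (R : realType) (l u : R[i]) (s : R) N :
  (1 - s%:C * u) * (\sum_(n < N) bcoef l n.+1 * n.+1%:R * u ^+ n.+1 * s%:C ^+ n)
  - l * u * (\sum_(n < N.+1) bcoef l n * (s%:C * u) ^+ n) =
  - (bcoef l N.+1 * N.+1%:R * u ^+ N.+1 * s%:C ^+ N).
Proof.
elim: N => [|N IH].
  rewrite big_ord0 big_ord_recl big_ord0 bcoefS bcoef0 mulr0 !expr0 expr1 mulr0n.
  ring.
rewrite big_ord_recr/= mulrDr [in X in _ - X]big_ord_recr/=.
rewrite [l * u * (_ + _)]mulrDr opprD addrACA IH.
rewrite (bcoefS l N.+1) exprMn !exprS; ring.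
Qed.

Lemma is_cderive_partial_sum (R : realType) (c : nat -> R[i]) (u : R[i]) (s : R) N :
  is_cderive (fun s => \sum_(n < N.+1) c n * (s%:C * u) ^+ n) s
    (\sum_(n < N) c n.+1 * n.+1%:R * u ^+ n.+1 * s%:C ^+ n).
Proof.
have dX n : is_cderive (fun s : R => (s%:C * u) ^+ n.+1) s
    (n.+1%:R * u ^+ n.+1 * s%:C ^+ n).
  have dl : is_cderive (fun s : R => s%:C * u) s u.
    rewrite (_ : (fun s => _) = (fun s : R => 0 + s%:C * u)).
      exact: is_cderive_line.
    by apply/funext => x; rewrite add0r.
  elim: n => [|n IH]; first by rewrite !expr1 expr0 !mulr1 mul1r.
  rewrite (_ : (fun s => _) = (fun s : R => (s%:C * u) * (s%:C * u) ^+ n.+1)).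
    apply: (is_cderive_eq (is_cderiveM dl IH)).
    rewrite exprMn -[in RHS]natr1 !exprS; ring.
  by apply/funext => x; rewrite exprS.
elim: N => [|N IH].
  rewrite big_ord0; under eq_fun do rewrite big_ord_recr big_ord0/= expr0.
  exact: is_cderive_cst.
under eq_fun do rewrite big_ord_recr/=.
rewrite big_ord_recr/=; apply: is_cderiveD => //.
apply: (is_cderive_eq (is_cderiveM (is_cderive_cst _ _) (dX N))).
ring.
Qed.

(** Let S_N(s) be the truncated series at s u and E(s) = (1 - s u)^l. By [binomial_ode] the
    derivative of S_N E contains the remainder term only, so S_N(1) E(1) differs from S_N(0) E(0) =
    1 by a quantity tending to 0. *)
Lemma binomial_series (R : realType) (l u : R[i]) : cmod u < 1 ->
  (fun N => \sum_(n < N) bcoef l n * u ^+ n) @ \oo --> cpow (1 - u) (- l).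
Proof.
move=> u1.
pose d := 1 - cmod u; have d0 : 0 < d by rewrite subr_gt0.
pose v (s : R) := 1 - s%:C * u.
have vd (s : R) : 0 <= s <= 1 -> d <= cmod (v s) <= 2.
  move=> /andP[s0 s1].
  have su : cmod (s%:C * u) <= cmod u.
    by rewrite cmodM cmod_real ger0_norm// ler_piMl ?cmod_ge0.
  apply/andP; split.
    by rewrite (le_trans _ (lerB_cmod _ _))// cmod1 lerD2l lerN2.
  by rewrite (le_trans (ler_cmodB _ _))// cmod1 lerD2l (le_trans su)// ltW.
have vs (s : R) : 0 <= s <= 1 -> slit (v s).
  move=> /andP[s0 s1]; apply/orP; right.
  rewrite /v Re_add Re_opp Re_mul/= mul0r subr0 subr_gt0.
  rewrite (le_lt_trans _ u1)// (le_trans (ler_norm _))// normrM.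
  by rewrite ger0_norm// (le_trans _ (ler_Re_cmod _))// ler_piMl.
pose E (s : R) := cexp (l * clog (v s)).
pose M := expR (cmod l * (`|ln d| + `|ln 2| + pi)).
have EM (s : R) : 0 <= s <= 1 -> cmod (E s) <= M.
  by move=> /vd/(ler_cmod_cpow l d0).
have dE (s : R) : 0 <= s <= 1 -> is_cderive E s (E s * (l * (- u / v s))).
  move=> s01; apply: is_cderive_cexp.
  have dv : is_cderive v s (- u).
    rewrite (_ : v = (fun s : R => 1 + s%:C * (- u))).
      exact: is_cderive_line.
    by apply/funext => x; rewrite mulrN.
  apply: (is_cderive_eq (is_cderiveM (is_cderive_cst l s)
    (is_cderive_clog dv (vs _ s01)))).
  by rewrite mul0r addr0.
pose S N (s : R) := \sum_(n < N.+1) bcoef l n * (s%:C * u) ^+ n.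
have key N : cmod (S N 1 * E 1 - S N 0 * E 0) <=
    2 * (cmod l * (cmod (bcoef (l + 1) N) * cmod u ^+ N) * (M / d)).
  have := @ler_cmod_increment _ (fun s => S N s * E s)
    (fun s => - (bcoef l N.+1 * N.+1%:R * u ^+ N.+1 * s%:C ^+ N) * (E s / v s))
    0 1 (cmod l * (cmod (bcoef (l + 1) N) * cmod u ^+ N) * (M / d)) ler01.
  rewrite subr0 mulr1; apply.
    move=> s s01; have := is_cderiveM (is_cderive_partial_sum (bcoef l) u s N) (dE _ s01).
    move=> k; apply: (is_cderive_eq k); rewrite -binomial_ode -/(v s).
    by field; exact: slit_neq0 (vs _ s01).
  move=> s s01; have /andP[s0 s1] := s01.
  (* The factor N + 1 in the remainder is absorbed by passing to the parameter l + 1, which leaves a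
     subexponential coefficient times |u|^N. *)
  rewrite bcoefSl; move: (bcoef (l + 1) N) (E s) (EM _ s01) => b e eM.
  rewrite cmodM cmodN !cmodM !cmodX cmodV cmod_real ger0_norm//.
  apply: ler_pM => //; rewrite ?mulr_ge0 ?invr_ge0 ?exprn_ge0 ?cmod_ge0//.
    rewrite exprS -!mulrA ler_wpM2l ?cmod_ge0// ler_wpM2l ?cmod_ge0//.
    rewrite mulrCA -[leRHS]mulr1 ler_wpM2l ?exprn_ge0 ?cmod_ge0//.
    by rewrite mulr_ile1 ?cmod_ge0 ?exprn_ge0 ?exprn_ile1// ltW.
  have /andP[dv _] := vd _ s01.
  apply: ler_pM; rewrite ?invr_ge0 ?cmod_ge0//.
  by rewrite lef_pV2 ?posrE// (lt_le_trans d0).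
have E1 : E 1 * cpow (1 - u) (- l) = 1.
  by rewrite /E /v mul1r /cpow -cexpD mulNr subrr cexp0.
have S0 N : S N 0 * E 0 = 1.
  rewrite /E /v mul0r subr0 clog1 mulr0 cexp0 mulr1 /S big_ord_recl bcoef0 !mul1r.
  by rewrite expr0 big1 ?addr0// => i _; rewrite mul0r expr0n mulr0.
(* [S N] has N + 1 terms, hence the shift of the index. *)
rewrite -cvg_shiftS.
apply: (@cvg_cmod _ _ _ (fun N => 2 * (cmod l * (cmod (bcoef (l + 1) N) * cmod u ^+ N)
   * (M / d)) * cmod (cpow (1 - u) (- l)))).
  move=> N.
  have -> : \sum_(n < N.+1) bcoef l n * u ^+ n - cpow (1 - u) (- l) =
     (S N 1 * E 1 - S N 0 * E 0) * cpow (1 - u) (- l).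
    rewrite mulrBl -mulrA E1 mulr1 S0 mul1r /S; congr (_ - _).
    by apply: eq_bigr => i _; rewrite mul1r.
  by rewrite cmodM ler_wpM2r// cmod_ge0.
have := @subexp_cvg0 _ (fun n => cmod (bcoef (l + 1) n)) (cmod u).
move=> /(_ _ (subexp_bcoef _)); rewrite cmod_ge0 u1 => k.
have {}k := k (fun n => cmod_ge0 _) isT.
rewrite (_ : (fun N => _) = (fun N => (2 * cmod l * (M / d) * cmod (cpow (1 - u) (- l)))
  * (cmod (bcoef (l + 1) N) * cmod u ^+ N))); last first.
  by apply/funext => N; ring.
by rewrite -[X in _ --> X](mulr0 (2 * cmod l * (M / d) * cmod (cpow (1 - u) (- l)))); apply: cvgMr.
Qed.

(** * The logarithmic form of the Pfaff identity *)

Lemma slit_inv (R : realType) (z : R[i]) : slit z -> slit z^-1.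
Proof.
move=> zs; have := slit_neq0 zs; rewrite -cmod_gt0 => /(exprn_gt0 2).
rewrite cmod_sqr; move: zs; case: z => x y /=; rewrite /slit /= => h p.
case/orP: h => h; apply/orP; [left|right].
- by rewrite oppr_eq0 mulf_neq0// invr_eq0 gt_eqF.
- by rewrite divr_gt0.
Qed.

(** The slit plane is star-shaped about 1. *)
Lemma slit_segment (R : realType) (z : R[i]) (s : R) :
  slit (1 - z) -> 0 <= s <= 1 -> slit (1 - s%:C * z).
Proof.
case: z => x y; rewrite /slit /= => h /andP[s0 s1].
rewrite !mul0r subr0 addr0 !sub0r !oppr_eq0 in h *.
move: s0; rewrite le_eqVlt => /predU1P[<-|s0].
  by rewrite !mul0r subr0 ltr01 orbT.
case/orP: h => h; apply/orP; [left|right]; first by rewrite mulf_neq0// gt_eqF.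
have [x0|x0] := lerP x 0; first by rewrite subr_gt0 (le_lt_trans _ ltr01)// pmulr_rle0.
by rewrite subr_gt0 (le_lt_trans (ler_piMl (ltW x0) s1))// -subr_gt0.
Qed.

(** The segment from 1 to 1 - z avoids 0, so principal powers are bounded along it. The distance [d]
    is made explicit according to the two alternatives of [slit]. *)
Lemma segment_cmod_bound (R : realType) (z : R[i]) : slit (1 - z) ->
  exists2 d : R, 0 < d & forall s : R, 0 <= s <= 1 ->
    d <= cmod (1 - s%:C * z) <= 1 + cmod z.
Proof.
move=> zs.
have up (s : R) : 0 <= s <= 1 -> cmod (1 - s%:C * z) <= 1 + cmod z.
  move=> /andP[s0 s1]; rewrite (le_trans (ler_cmodB _ _))// cmod1 lerD2l.
  by rewrite cmodM cmod_real ger0_norm// ler_piMl ?cmod_ge0.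
case/orP: (zs); rewrite ?Re_add ?Im_add ?Re_opp ?Im_opp/= => h.
- rewrite sub0r oppr_eq0 in h.
  have z0 : 0 < cmod z by rewrite cmod_gt0; apply: contraNneq h => ->.
  exists (`|Im z| / cmod z); first by rewrite divr_gt0// normr_gt0.
  move=> s s01; rewrite up// andbT ler_pdivrMr//.
  (* Multiplication by the conjugate of z removes s from the imaginary part: that of (1 - s z) times
     the conjugate of z is - Im z. *)
  have -> : cmod z = cmod (Re z -i* Im z) by rewrite /cmod/= sqrrN.
  rewrite -cmodM (le_trans _ (ler_Im_cmod _))//.
  rewrite Im_mul Re_add Im_add Re_opp Im_opp Re_mul Im_mul/=.
  rewrite (_ : _ + _ = - Im z); first by rewrite normrN.
  by ring.
- exists (Num.min 1 (1 - Re z)); first by rewrite lt_min ltr01.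
  move=> s /[dup] /andP[s0 s1] s01; rewrite up// andbT.
  apply: le_trans (ler_Re_cmod _); apply: le_trans (ler_norm _).
  rewrite Re_add Re_opp Re_mul/= mul0r subr0 ge_min; apply/orP.
  have [x0|x0] := lerP (Re z) 0; [left|right].
    by rewrite lerBrDr -lerBrDl subrr mulr_ge0_le0.
  by rewrite lerD2l lerN2 ler_piMl// ltW.
Qed.

(* Both sides have derivative [- z / (1 - s z)] in [s] and agree at [s = 1]. *)
Lemma clog_pfaff (R : realType) (z : R[i]) (s : R) :
  slit (1 - z) -> 0 <= s <= 1 ->
  clog (1 - s%:C * z) = clog (1 - z) + clog (1 - (1 - s)%:C * (z / (z - 1))).
Proof.
move=> zs s01; have z1 := slit_neq0 zs.
have z1' : z - 1 != 0 by rewrite -opprB oppr_eq0.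
pose v (r : R) := 1 - r%:C * z.
pose w (r : R) := 1 - (1 - r)%:C * (z / (z - 1)).
have vw r : w r = v r / (1 - z).
  rewrite /w /v rmorphB/= rmorph1; move: z1 z1'; move: (r%:C) => r' z1 z1'.
  by field; rewrite z1 z1'.
have vs r : 0 <= r <= 1 -> slit (v r) by exact: slit_segment.
have ws r : 0 <= r <= 1 -> slit (w r).
  move=> /andP[r0 r1]; apply: slit_segment; last by rewrite subr_ge0 r1 lerBlDr lerDl.
  have -> : 1 - z / (z - 1) = (1 - z)^-1 by field; rewrite z1 z1'.
  exact: slit_inv.
have dv r : is_cderive v r (- z).
  rewrite (_ : v = fun r : R => 1 + r%:C * (- z)); first exact: is_cderive_line.
  by apply/funext => x; rewrite mulrN.
have dw r : is_cderive w r (- z / (1 - z)).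
  rewrite (_ : w = fun r : R => (1 - z)^-1 + r%:C * (- z / (1 - z))).
    exact: is_cderive_line.
  apply/funext => x; rewrite vw /v; move: (x%:C) => x'; by field.
have L r : 0 <= r <= 1 ->
    is_cderive (fun r => clog (v r) + - clog (w r)) r 0.
  move=> r01; apply: (is_cderive_eq (is_cderiveD
    (is_cderive_clog (dv r) (vs _ r01))
    (is_cderiveN (is_cderive_clog (dw r) (ws _ r01))))).
  have v0 := slit_neq0 (vs _ r01).
  by rewrite vw; field; rewrite v0 z1.
have /andP[s0 s1] := s01.
(* With derivative bound 0 on [s, 1], the increment estimate says that the difference of logarithms
   is constant. *)
have := @ler_cmod_increment _ (fun x => clog (v x) + - clog (w x)) (fun=> 0) s 1 0 s1.
rewrite mul0r mulr0 => H.
have /eqP : cmod (clog (v 1) + - clog (w 1) - (clog (v s) + - clog (w s))) == 0.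
  rewrite eq_le cmod_ge0 andbT; apply: H => t /andP[t0 t1].
    by apply: L; rewrite t1 (le_trans s0).
  by rewrite cmod0.
move/eqP; rewrite cmod_eq0 subr_eq0 => /eqP.
rewrite /w /v subrr !mul0r subr0 clog1 subr0 mul1r => ->.
by rewrite subrK.
Qed.

(** * Integration of complex-valued functions *)

Section integration.
Variable R : realType.
Local Notation mu := (@lebesgue_measure R).
Implicit Types (D : set (measurableTypeR R)) (f k : R -> R[i]) (g h : R -> R).

Lemma Rintegral_dominated_cvg D (f_ : nat -> R -> R) g h :
  measurable D -> (forall n, measurable_fun D (f_ n)) ->
  (forall x, D x -> f_ ^~ x @ \oo --> g x) ->
  mu.-integrable D (EFin \o h) -> (forall n x, D x -> `|f_ n x| <= h x) ->
  (fun n => Rintegral mu D (f_ n)) @ \oo --> Rintegral mu D g.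
Proof.
move=> mD mf fg ih fh.
have mg : measurable_fun D g by exact: measurable_fun_cvg fg.
have [||||| ig _ H] := @dominated_convergence _ _ _ mu D mD
  (fun n x => (f_ n x)%:E) (fun x => (g x)%:E) (EFin \o h).
- by move=> n; exact/measurable_EFinP.
- exact/measurable_EFinP.
- by apply: aeW => x Dx; apply: cvg_EFin; [exact: nearW|exact: fg].
- exact: ih.
- by apply: aeW => x n Dx /=; rewrite lee_fin fh.
have H' : (fun n => \int[mu]_(x in D) (f_ n x)%:E)%E @ \oo --> (Rintegral mu D g)%:E.
  by rewrite /Rintegral fineK//; exact: integrable_fin_num.
exact: fine_cvg H'.
Qed.

Definition cmeasurable D k :=
  measurable_fun D (fun t => Re (k t)) /\ measurable_fun D (fun t => Im (k t)).

Lemma cintegrable_cmeasurable D f : cintegrable D f -> cmeasurable D f.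
Proof.
by move=> [/(measurable_int mu) f1 /(measurable_int mu) f2]; split;
  exact/measurable_EFinP.
Qed.

Lemma cmeasurableM D k k' : cmeasurable D k -> cmeasurable D k' ->
  cmeasurable D (fun t => k t * k' t).
Proof.
move=> [r1 i1] [r2 i2]; split.
- under eq_fun do rewrite Re_mul.
  by apply: measurable_funB; apply: measurable_funM.
- under eq_fun do rewrite Im_mul.
  by apply: measurable_funD; apply: measurable_funM.
Qed.

Lemma cmeasurable_cst D (c : R[i]) : cmeasurable D (fun=> c).
Proof. by split; exact: measurable_cst. Qed.

Lemma cmeasurable_real D g : measurable_fun D g -> cmeasurable D (fun t => (g t)%:C).
Proof. by split. Qed.

Lemma cmeasurableX D k n : cmeasurable D k -> cmeasurable D (fun t => k t ^+ n).
Proof.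
move=> mk; elim: n => [|n IH]; first exact: cmeasurable_cst.
by under eq_fun do rewrite exprS; exact: cmeasurableM.
Qed.

Lemma cmeasurable_sum D (k_ : nat -> R -> R[i]) N :
  (forall n, cmeasurable D (k_ n)) -> cmeasurable D (fun t => \sum_(n < N) k_ n t).
Proof.
move=> mk; elim: N => [|N [r i]].
  by under eq_fun do rewrite big_ord0; exact: cmeasurable_cst.
split.
- under eq_fun do rewrite big_ord_recr Re_add.
  by apply: measurable_funD => //; have [] := mk N.
- under eq_fun do rewrite big_ord_recr Im_add.
  by apply: measurable_funD => //; have [] := mk N.
Qed.

Lemma cmeasurable_cvg D (k_ : nat -> R -> R[i]) k :
  measurable D -> (forall n, cmeasurable D (k_ n)) ->
  (forall x, D x -> k_ ^~ x @ \oo --> k x) -> cmeasurable D k.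
Proof.
move=> mD mk kk; split.
- apply: (@measurable_fun_cvg _ _ _ _ (fun n t => Re (k_ n t))) => // [n|x Dx].
    by have [] := mk n.
  by have /cvg_complexP[] := kk _ Dx.
- apply: (@measurable_fun_cvg _ _ _ _ (fun n t => Im (k_ n t))) => // [n|x Dx].
    by have [] := mk n.
  by have /cvg_complexP[] := kk _ Dx.
Qed.

Lemma integrable_cmod D f : measurable D -> cintegrable D f ->
  mu.-integrable D (EFin \o (fun t => `|Re (f t)| + `|Im (f t)|)).
Proof.
move=> mD [f1 f2].
have n1 := @integrable_norm _ _ _ mu _ (fun t => Re (f t)) f1.
have n2 := @integrable_norm _ _ _ mu _ (fun t => Im (f t)) f2.
exact: (integrableD mD n1 n2).
Qed.

Lemma cintegrable_dominated D f h : measurable D -> cmeasurable D f ->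
  mu.-integrable D (EFin \o h) -> (forall t, D t -> cmod (f t) <= h t) ->
  cintegrable D f.
Proof.
move=> mD [m1 m2] ih fh; split; apply: (le_integrable mD _ _ ih).
- exact/measurable_EFinP.
- move=> x Dx /=; rewrite lee_fin (le_trans _ (ler_norm _))//.
  by rewrite (le_trans (ler_Re_cmod _)) ?fh.
- exact/measurable_EFinP.
- move=> x Dx /=; rewrite lee_fin (le_trans _ (ler_norm _))//.
  by rewrite (le_trans (ler_Im_cmod _)) ?fh.
Qed.

Lemma ler_cmodM_ReIm (M : R) (x y : R[i]) :
  cmod x <= M -> cmod (x * y) <= M * (`|Re y| + `|Im y|).
Proof. by move=> xM; rewrite cmodM ler_pM ?cmod_ge0 ?ler_cmod_ReIm. Qed.

Lemma cintegrableM D k f (M : R) : measurable D -> cmeasurable D k ->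
  (forall t, D t -> cmod (k t) <= M) -> cintegrable D f ->
  cintegrable D (fun t => k t * f t).
Proof.
move=> mD mk kM fi.
apply: (@cintegrable_dominated _ _ (fun t => M * (`|Re (f t)| + `|Im (f t)|))) => //.
- exact/(cmeasurableM mk)/cintegrable_cmeasurable.
- exact: (integrableZl mD M (integrable_cmod mD fi)).
- by move=> t Dt; rewrite ler_cmodM_ReIm ?kM.
Qed.

(** The form in which limits pass under complex integrals below: uniformly bounded kernels against a
    fixed integrable f, dominated by M (|Re f| + |Im f|). *)
Lemma cintegral_dominated_cvg D (k_ : nat -> R -> R[i]) k f (M : R) :
  measurable D -> (forall n, cmeasurable D (k_ n)) ->
  (forall n t, D t -> cmod (k_ n t) <= M) ->
  (forall x, D x -> k_ ^~ x @ \oo --> k x) -> cintegrable D f ->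
  (fun n => cintegral D (fun t => k_ n t * f t)) @ \oo -->
  cintegral D (fun t => k t * f t).
Proof.
move=> mD mk kM kk fi.
have ih := integrableZl mD M (integrable_cmod mD fi).
have mkf n := cmeasurableM (mk n) (cintegrable_cmeasurable fi).
have kf x : D x -> (fun n => k_ n x * f x) @ \oo --> k x * f x.
  by move=> Dx; exact: (@cvgM R[i] _ _ eventually_filter _ _ _ _ (kk _ Dx)
    (@cvg_cst R[i] _ _ _ _)).
apply/cvg_complexP; split.
- apply: (Rintegral_dominated_cvg mD (f_ := fun n t => Re (k_ n t * f t)) _ _ ih).
  + by move=> n; have [] := mkf n.
  + by move=> x Dx; have /cvg_complexP[] := kf _ Dx.
  + move=> n x Dx; rewrite (le_trans (ler_Re_cmod _))//.
    exact/ler_cmodM_ReIm/kM.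
- apply: (Rintegral_dominated_cvg mD (f_ := fun n t => Im (k_ n t * f t)) _ _ ih).
  + by move=> n; have [] := mkf n.
  + by move=> x Dx; have /cvg_complexP[] := kf _ Dx.
  + move=> n x Dx; rewrite (le_trans (ler_Im_cmod _))//.
    exact/ler_cmodM_ReIm/kM.
Qed.

Lemma eq_cintegral D f f' : (forall t, D t -> f t = f' t) ->
  cintegral D f = cintegral D f'.
Proof.
move=> ff; rewrite /cintegral; congr (_ +i* _); apply: eq_Rintegral => t.
  by rewrite inE => /ff ->.
by rewrite inE => /ff ->.
Qed.

Lemma cintegralD D f f' : measurable D -> cintegrable D f -> cintegrable D f' ->
  cintegral D (fun t => f t + f' t) = cintegral D f + cintegral D f'.
Proof.
move=> mD [f1 f2] [g1 g2]; apply: complexP; rewrite ?Re_add ?Im_add /=.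
- rewrite -RintegralD//; apply: eq_Rintegral => t _; exact: Re_add.
- rewrite -RintegralD//; apply: eq_Rintegral => t _; exact: Im_add.
Qed.

Lemma cintegralZ D f (c : R[i]) : measurable D -> cintegrable D f ->
  cintegral D (fun t => c * f t) = c * cintegral D f.
Proof.
move=> mD [f1 f2]; apply: complexP; rewrite ?Re_mul ?Im_mul /= -!RintegralZl//.
- rewrite -RintegralB//; first by apply: eq_Rintegral => t _; exact: Re_mul.
    exact: (integrableZl mD (Re c) f1).
  exact: (integrableZl mD (Im c) f2).
- rewrite -RintegralD//; first by apply: eq_Rintegral => t _; exact: Im_mul.
    exact: (integrableZl mD (Re c) f2).
  exact: (integrableZl mD (Im c) f1).
Qed.

Lemma cintegrableZ D f (c : R[i]) : measurable D -> cintegrable D f ->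
  cintegrable D (fun t => c * f t).
Proof.
by move=> mD; exact: (@cintegrableM D _ f (cmod c) mD (cmeasurable_cst D c)).
Qed.

Lemma cintegrableD D f f' : measurable D -> cintegrable D f -> cintegrable D f' ->
  cintegrable D (fun t => f t + f' t).
Proof.
move=> mD [f1 f2] [g1 g2]; split.
- under eq_fun do rewrite Re_add; exact: (integrableD mD f1 g1).
- under eq_fun do rewrite Im_add; exact: (integrableD mD f2 g2).
Qed.

Lemma cintegral0 D : cintegral D (fun=> 0) = 0.
Proof.
have z : Rintegral mu D (fun=> 0) = 0 by rewrite /Rintegral integral0.
by apply: complexP => /=; exact: z.
Qed.

Lemma cintegral_sum D (f_ : nat -> R -> R[i]) N : measurable D ->
  (forall n, cintegrable D (f_ n)) ->
  cintegrable D (fun t => \sum_(n < N) f_ n t) /\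
  cintegral D (fun t => \sum_(n < N) f_ n t) = \sum_(n < N) cintegral D (f_ n).
Proof.
move=> mD fi; elim: N => [|N [IH1 IH2]].
  rewrite big_ord0; under eq_fun do rewrite big_ord0; rewrite cintegral0.
  by split => //; split; exact: integrable0.
rewrite big_ord_recr/=; under eq_fun do rewrite big_ord_recr/=.
by split; [exact: cintegrableD|rewrite cintegralD// IH2].
Qed.

Lemma cintegrableS D D' f : measurable D -> measurable D' -> D' `<=` D ->
  cintegrable D f -> cintegrable D' f.
Proof. by move=> mD mD' DD [f1 f2]; split; exact: (integrableS mD). Qed.

Lemma cintegral_setU D D' f : measurable D -> measurable D' ->
  cintegrable (D `|` D') f -> [disjoint D & D'] ->
  cintegral (D `|` D') f = cintegral D f + cintegral D' f.
Proof.
move=> mD mD' [f1 f2] dis; apply: complexP; rewrite ?Re_add ?Im_add /=.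
- exact: Rintegral_setU.
- exact: Rintegral_setU.
Qed.

End integration.

(** * Abel's theorem *)

Lemma cvg_unique_complex (R : realType) (u : nat -> R[i]) (a b : R[i]) :
  u @ \oo --> a -> u @ \oo --> b -> a = b.
Proof.
move=> /cvg_complexP[a1 a2] /cvg_complexP[b1 b2].
by apply: complexP; [exact: cvg_unique a1 b1|exact: cvg_unique a2 b2].
Qed.

Lemma cvg_bounded_real (R : realType) (u : nat -> R) (a : R) :
  u @ \oo --> a -> exists2 M, 0 <= M & forall n, `|u n| <= M.
Proof.
move=> /cvgP/cvg_seq_bounded/pinfty_ex_gt0[M M0 /= uM].
by exists M => [|n]; [exact: ltW|exact: uM].
Qed.

Lemma cvg_bounded_complex (R : realType) (u : nat -> R[i]) (a : R[i]) :
  u @ \oo --> a -> exists2 M, 0 <= M & forall n, cmod (u n) <= M.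
Proof.
move=> /cvg_complexP[/cvg_bounded_real[M M0 HM] /cvg_bounded_real[N N0 HN]].
exists (M + N); first exact: addr_ge0.
by move=> n; rewrite (le_trans (ler_cmod_ReIm _))// lerD.
Qed.

(** The factor 2 comes from treating the two components separately; it is harmless where the bound
    itself tends to 0. *)
Lemma cmod_lim_le (R : realType) (u : nat -> R[i]) (a : R[i]) (B : R) :
  u @ \oo --> a -> (forall n, cmod (u n) <= B) -> cmod a <= 2 * B.
Proof.
have H (v : nat -> R) x : v @ \oo --> x -> (forall n, `|v n| <= B) -> `|x| <= B.
  move=> vx vB; apply: (cvgr_to_le (cvg_norm vx)); exact: nearW.
move=> /cvg_complexP[u1 u2] uB.
rewrite (le_trans (ler_cmod_ReIm _))// mulr_natl mulr2n lerD//.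
  by apply: H u1 _ => n; rewrite (le_trans (ler_Re_cmod _)).
by apply: H u2 _ => n; rewrite (le_trans (ler_Im_cmod _)).
Qed.

(** Summation by parts turns the power series into S plus (1 - x) times a series in the errors d_n
    of the partial sums. The first N0 errors are bounded by M and their contribution vanishes with 1
    - x; the others are below e / 3, and (1 - x) times the geometric sum is at most 1. *)
Lemma abel_real (R : realType) (a : nat -> R) (S : R) (r T : nat -> R) :
  (fun N => \sum_(n < N) a n) @ \oo --> S ->
  (forall k, 0 <= r k < 1) -> r @ \oo --> (1 : R) ->
  (forall k, (fun N => \sum_(n < N) a n * r k ^+ n) @ \oo --> T k) ->
  T @ \oo --> S.
Proof.
move=> aS r01 r1 aT.
pose d N := \sum_(n < N) a n - S.
have d0 : d @ \oo --> 0.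
  by rewrite -(subrr S); apply: cvgB => //; exact: cvg_cst.
have parts x N : \sum_(n < N) a n * x ^+ n =
    d N * x ^+ N + S + (1 - x) * \sum_(n < N) d n.+1 * x ^+ n.
  elim: N => [|N IH]; first by rewrite /d !big_ord0; ring.
  rewrite !big_ord_recr/= IH /d big_ord_recr/= exprS; ring.
have [M M0 dM] := cvg_bounded_real d0.
apply/cvgrPdist_le => e e0.
have e3 : 0 < e / 3 by rewrite divr_gt0.
have [N0 _ HN0] : \forall n \near \oo, `|d n| < e / 3.
  by apply: (cvgr0_norm_lt _ d0).
have bound x N : 0 <= x < 1 ->
    \sum_(n < N) `|d n.+1| * x ^+ n <=
    (minn N N0)%:R * M + e / 3 * \sum_(n < N) x ^+ n.
  move=> /andP[x0 x1]; have xn n : 0 <= x ^+ n by rewrite exprn_ge0.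
  elim: N => [|N IH]; first by rewrite !big_ord0 min0n mul0r mulr0 addr0.
  rewrite !big_ord_recr/=; have [NN|NN] := ltnP N N0.
    move: IH; rewrite (minn_idPl (ltnW NN)) (minn_idPl NN) => IH.
    rewrite (le_trans (lerD IH (_ : _ <= M)))//.
      by rewrite (le_trans (ler_piMr _ (exprn_ile1 _ _ _)))// ltW.
    rewrite -[N.+1%:R]natr1 mulrDl mul1r mulrDr addrAC -!addrA !lerD2l lerDl.
    by rewrite mulr_ge0// ltW.
  move: IH; rewrite (minn_idPr NN) (minn_idPr (leqW NN)) => IH.
  rewrite mulrDr addrA lerD// ler_wpM2r// ltW// HN0//= ltnW//.
have T_le k : `|S - T k| <= e / 3 + ((1 - r k) * (N0%:R * M) + e / 3).
  have /andP[r0 r1'] := r01 k.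
  have c : (fun N => `|S - \sum_(n < N) a n * r k ^+ n|) @ \oo --> `|S - T k|.
    by apply: cvg_norm; apply: cvgB => //; exact: cvg_cst.
  apply: (cvgr_to_le c).
  exists N0 => // N /= N0N; rewrite parts.
  rewrite (_ : _ - _ = - (d N * r k ^+ N + (1 - r k) * \sum_(n < N) d n.+1 * r k ^+ n)); last by ring.
  rewrite normrN (le_trans (ler_normD _ _))// lerD//.
    rewrite normrM (le_trans (ler_piMr _ _))//.
      by rewrite normrX exprn_ile1// ger0_norm// ltW.
    by rewrite ltW// HN0.
  rewrite normrM (ger0_norm (_ : 0 <= 1 - r k)) ?subr_ge0 ?(ltW r1')//.
  apply: (@le_trans _ _ ((1 - r k) * (N0%:R * M + e / 3 * \sum_(n < N) r k ^+ n))).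
    rewrite ler_wpM2l ?subr_ge0 ?(ltW r1')//.
    rewrite (le_trans (ler_norm_sum _ _ _))//.
    apply: le_trans (le_trans (bound (r k) N (r01 k)) _); last first.
      by rewrite lerD2r ler_wpM2r// ler_nat geq_minr.
    apply: ler_sum => i _; rewrite normrM normrX (ger0_norm r0)//.
  rewrite mulrDr lerD2l mulrCA -[leRHS]mulr1 ler_wpM2l ?(ltW e3)//.
  by rewrite mulrC -ler_pdivlMr ?subr_gt0// mul1r geo_partial_sum// r0.
have [K _ HK] : \forall k \near \oo, `|(1 - r k) * (N0%:R * M)| < e / 3.
  apply: cvgr0_norm_lt => //.
  rewrite -(mul0r (N0%:R * M)) -(subrr 1); apply: cvgMl; apply: cvgB => //; exact: cvg_cst.
exists K => // k /= Kk; rewrite (le_trans (T_le k))//.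
have := HK k Kk; rewrite ltr_norml => /andP[_ h]; lra.
Qed.

Lemma abel_complex (R : realType) (a : nat -> R[i]) (S : R[i]) (r : nat -> R)
    (T : nat -> R[i]) :
  (fun N => \sum_(n < N) a n) @ \oo --> S ->
  (forall k, 0 <= r k < 1) -> r @ \oo --> (1 : R) ->
  (forall k, (fun N => \sum_(n < N) a n * (r k)%:C ^+ n) @ \oo --> T k) ->
  T @ \oo --> S.
Proof.
move=> /cvg_complexP[a1 a2] r01 r1 aT.
have rX (x : R) n : x%:C ^+ n = (x ^+ n)%:C by rewrite rmorphXn.
apply/cvg_complexP; split.
- apply: (@abel_real _ (fun n => Re (a n)) _ r _ _ r01 r1) => [|k].
    rewrite (_ : (fun N => _) = (fun N => Re (\sum_(n < N) a n)))//.
    by apply/funext => N; rewrite Re_sum.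
  have /cvg_complexP[h _] := aT k.
  rewrite (_ : (fun N => _) = (fun N => Re (\sum_(n < N) a n * (r k)%:C ^+ n)))//.
  apply/funext => N; rewrite Re_sum; apply: eq_bigr => i _.
  by rewrite rX Re_mul/= mulr0 subr0.
- apply: (@abel_real _ (fun n => Im (a n)) _ r _ _ r01 r1) => [|k].
    rewrite (_ : (fun N => _) = (fun N => Im (\sum_(n < N) a n)))//.
    by apply/funext => N; rewrite Im_sum.
  have /cvg_complexP[_ h] := aT k.
  rewrite (_ : (fun N => _) = (fun N => Im (\sum_(n < N) a n * (r k)%:C ^+ n)))//.
  apply/funext => N; rewrite Im_sum; apply: eq_bigr => i _.
  by rewrite rX Im_mul/= mulr0 add0r.
Qed.

(** * Abel summation of binomial series of moments *)

Section moments.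
Variable R : realType.
Variables (E : set (measurableTypeR R)) (f : R -> R[i]) (g : R -> R).
Hypotheses (mE : measurable E) (fi : cintegrable E f) (mg : measurable_fun E g).
Hypothesis g01 : forall t, E t -> 0 <= g t <= 1.

Let mgX n : cmeasurable E (fun t => (g t)%:C ^+ n).
Proof. exact/cmeasurableX/cmeasurable_real. Qed.

Let gX1 n t : E t -> cmod ((g t)%:C ^+ n) <= 1.
Proof.
move=> /g01/andP[g0 g1].
by rewrite cmodX cmod_real ger0_norm// exprn_ile1.
Qed.

Let gfi n : cintegrable E (fun t => (g t)%:C ^+ n * f t).
Proof. exact: (cintegrableM mE (mgX n) (@gX1 n) fi). Qed.

Lemma cintegral_power_sum (c : nat -> R[i]) N :
  cintegral E (fun t => (\sum_(n < N) c n * (g t)%:C ^+ n) * f t) =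
  \sum_(n < N) c n * cintegral E (fun t => (g t)%:C ^+ n * f t).
Proof.
transitivity (cintegral E (fun t => \sum_(n < N) c n * ((g t)%:C ^+ n * f t))).
  by apply: eq_cintegral => t _; rewrite mulr_suml; apply: eq_bigr => i _; rewrite mulrA.
rewrite (cintegral_sum N mE (fun n => cintegrableZ (c n) mE (gfi n))).2.
by apply: eq_bigr => i _; rewrite cintegralZ.
Qed.

(** At radius r < 1 the condition |u| g <= 1 gives |r g u| <= r, so the partial sums of the binomial
    series are uniformly bounded and may be integrated in the limit. Then r tends to 1:
    [abel_complex] handles the series, dominated convergence the integral. *)
Lemma abel_binomial_integral (l u S : R[i]) : slit (1 - u) ->
  (forall t, E t -> cmod u * g t <= 1) ->
  (fun N => \sum_(n < N) bcoef l n * u ^+ n *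
     cintegral E (fun t => (g t)%:C ^+ n * f t)) @ \oo --> S ->
  cintegrable E (fun t => cpow (1 - (g t)%:C * u) (- l) * f t) /\
  S = cintegral E (fun t => cpow (1 - (g t)%:C * u) (- l) * f t).
Proof.
move=> us ug aS.
pose k_ (r : R) N t := \sum_(n < N) bcoef l n * u ^+ n * r%:C ^+ n * (g t)%:C ^+ n.
pose k (r : R) t := cpow (1 - (r * g t)%:C * u) (- l).
have rug (r : R) t : 0 <= r -> E t -> cmod ((r * g t)%:C * u) <= r.
  move=> r0 Et; have /andP[g0 _] := g01 Et.
  rewrite rmorphM -mulrA cmodM !cmod_real (ger0_norm r0) ler_piMr//.
  rewrite cmodM cmod_real (ger0_norm g0) mulrC. exact: ug.
have k_E (r : R) N t : k_ r N t = \sum_(n < N) bcoef l n * ((r * g t)%:C * u) ^+ n.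
  apply: eq_bigr => i _; rewrite rmorphM/= !exprMn; ring.
have mk_ r N : cmeasurable E (k_ r N).
  apply: (@cmeasurable_sum _ _ (fun n t => bcoef l n * u ^+ n * r%:C ^+ n * (g t)%:C ^+ n)).
  by move=> n; apply: cmeasurableM => //; exact: cmeasurable_cst.
have k_k (r : R) t : 0 <= r < 1 -> E t -> k_ r ^~ t @ \oo --> k r t.
  move=> /andP[r0 r1] Et; have -> : k_ r ^~ t = (fun N => \sum_(n < N) bcoef l n * ((r * g t)%:C * u) ^+ n).
    by apply/funext => N; exact: k_E.
  by apply: binomial_series; rewrite (le_lt_trans (rug _ _ r0 Et)).
have mk (r : R) : 0 <= r < 1 -> cmeasurable E (k r).
  by move=> r01; apply: (@cmeasurable_cvg _ _ (k_ r) (k r) mE (mk_ r)) => t Et; exact: k_k.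
have Tk (r : R) : 0 <= r < 1 ->
    (fun N => \sum_(n < N) (bcoef l n * u ^+ n *
      cintegral E (fun t => (g t)%:C ^+ n * f t)) * r%:C ^+ n) @ \oo -->
    cintegral E (fun t => k r t * f t).
  move=> /[dup] r01 /andP[r0 r1].
  have [B B0 HB] := subexp_sum (subexp_bcoef l) r01.
  rewrite (_ : (fun N => _) = (fun N => cintegral E (fun t => k_ r N t * f t))).
    have k_B n t : E t -> cmod (k_ r n t) <= B.
      move=> Et; rewrite k_E (le_trans (ler_cmod_sum _ _ _))// (le_trans _ (HB n))//.
      apply: ler_sum => i _; rewrite cmodM cmodX ler_wpM2l ?cmod_ge0//.
      by rewrite lerXn2r ?nnegrE ?cmod_ge0// rug.
    exact: (@cintegral_dominated_cvg _ _ (k_ r) (k r) f B mE (mk_ r) k_B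
      (fun t => @k_k r t r01) fi).
  apply/funext => N.
  rewrite /k_ (cintegral_power_sum (fun n => bcoef l n * u ^+ n * r%:C ^+ n)).
  by apply: eq_bigr => i _; rewrite mulrAC.
pose r_ (j : nat) : R := 1 - j.+1%:R^-1.
have r01 j : 0 <= r_ j < 1.
  rewrite /r_ subr_ge0 ltrBlDr ltrDl invr_gt0 ltr0n andbT.
  by rewrite invf_le1 ?ltr0n// ler1n.
have r1 : r_ @ \oo --> (1 : R).
  rewrite -[X in _ --> X]subr0; apply: cvgB; first exact: cvg_cst.
  exact: cvg_harmonic.
(* For 0 <= s <= 1 the number 1 - s u stays at distance at least d from 0, so the powers are bounded
   uniformly in both the radius and t. *)
have [d d0 HD] := segment_cmod_bound us.
pose M := expR (cmod (- l) * (`|ln d| + `|ln (1 + cmod u)| + pi)).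
have kM' (s : R) : 0 <= s <= 1 -> cmod (cpow (1 - s%:C * u) (- l)) <= M.
  by move=> s01; apply: ler_cmod_cpow => //; exact: HD.
have kM j t : E t -> cmod (k (r_ j) t) <= M.
  move=> Et; apply: kM'.
  have /andP[g0 g1] := g01 Et; have /andP[r0 /ltW r1'] := r01 j.
  by rewrite mulr_ge0//= mulr_ile1.
have kcvg t : E t -> (fun j => k (r_ j) t) @ \oo --> cpow (1 - (g t)%:C * u) (- l).
  move=> Et.
  have gs : slit (1 - (g t)%:C * u) by apply: slit_segment => //; exact: g01.
  (* Radial continuity of the principal power at s = 1 is read off from its differentiability in
     s. *)
  pose v (s : R) := 1 + s%:C * (- ((g t)%:C * u)).
  have vE (s : R) : 1 - (s * g t)%:C * u = v s by rewrite /v rmorphM/=; ring.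
  have v1 : v 1 = 1 - (g t)%:C * u by rewrite -vE mul1r.
  have dv : is_cderive (fun s => - l * clog (v s)) 1
      (- l * (- ((g t)%:C * u) / v 1)).
    have vs : slit (v 1) by rewrite v1.
    apply: (is_cderive_eq (is_cderiveM (is_cderive_cst _ _)
      (is_cderive_clog (is_cderive_line _ _ _) vs))).
    by rewrite mul0r addr0.
  have := is_cderive_cvg (is_cderive_cexp dv) r1.
  rewrite v1; apply: cvg_trans; apply: near_eq_cvg; apply: nearW => j.
  by rewrite /k vE.
have lim := @cintegral_dominated_cvg _ _ (fun j => k (r_ j)) _ f M mE
  (fun j => mk _ (r01 j)) kM kcvg fi.
pose a n := bcoef l n * u ^+ n * cintegral E (fun t => (g t)%:C ^+ n * f t).
have := @abel_complex _ a S r_ _ aS r01 r1 (fun j => Tk _ (r01 j)).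
move=> aT; split; last exact: cvg_unique_complex aT lim.
have mK := @cmeasurable_cvg _ _ (fun j => k (r_ j)) _ mE (fun j => mk _ (r01 j)) kcvg.
exact: (cintegrableM mE mK (fun t Et => kM' _ (g01 Et)) fi).
Qed.

End moments.

(** * Moments decaying faster than the support allows *)

Lemma exp_tail_cvg (R : realType) (x : R) :
  (fun m => \sum_(j < m) x ^+ j.+1 / j.+1`!%:R) @ \oo --> expR x - 1.
Proof.
have h : series (exp_coeff x) @ \oo --> expR x by exact: is_cvg_series_exp_coeff.
have -> : (fun m => \sum_(j < m) x ^+ j.+1 / j.+1`!%:R) =
    (fun m => series (exp_coeff x) m.+1 - 1).
  apply/funext => m; rewrite /series/= big_nat_recl//= big_mkord /exp_coeff/=.
  by rewrite expr0 fact0 divr1 addrC addKr.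
by apply: cvgB; [rewrite cvg_shiftS|exact: cvg_cst].
Qed.

Lemma exp_tail_le (R : realType) (x : R) m : 0 <= x ->
  \sum_(j < m) x ^+ j.+1 / j.+1`!%:R <= expR x - 1.
Proof.
move=> x0; have c := @exp_tail_cvg _ x.
rewrite -(cvg_lim _ c)//; apply: nondecreasing_cvgn_le; last exact: cvgP c.
apply/nondecreasing_seqP => n; rewrite big_ord_recr/= lerDl.
by rewrite divr_ge0// exprn_ge0.
Qed.

Section moments.
Variable R : realType.
Variables (E : set (measurableTypeR R)) (g : R -> R).
Hypotheses (mE : measurable E) (mg : measurable_fun E g).
Hypothesis g01 : forall t, E t -> 0 <= g t <= 1.

(** The pointwise limit of 1 - exp(-(x/a)^n) for x >= 0: the indicator of x > a, except at x = a,
    where every (x/a)^n equals 1. *)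
Definition step_avg (a x : R) : R :=
  if x < a then 0 else if x == a then 1 - expR (-1) else 1.

Lemma step_avg_cvg (a x : R) : 0 < a -> 0 <= x ->
  (fun n => 1 - expR (- (x / a) ^+ n)) @ \oo --> step_avg a x.
Proof.
move=> a0 x0; rewrite /step_avg.
have xa0 : 0 <= x / a by rewrite divr_ge0// ltW.
have [xa|xa|->] := ltgtP x a.
- have c : (fun n => - (x / a) ^+ n) @ \oo --> (0 : R).
    rewrite -oppr0; apply: cvgN; apply: cvg_expr.
    by rewrite ger0_norm// ltr_pdivrMr// mul1r.
  have e : (fun n => expR (- (x / a) ^+ n)) @ \oo --> expR 0.
    exact: (cvg_comp _ _ c (@continuous_expR R 0)).
  rewrite -(subrr 1) -[X in _ --> _ - X](@expR0 R); apply: cvgB e; exact: cvg_cst.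
- have q1 : 1 < x / a by rewrite ltr_pdivlMr// mul1r.
  have e : (fun n => expR (- (x / a) ^+ n)) @ \oo --> (0 : R).
    apply: (@squeeze_cvgr _ _ _ _ (fun=> 0) (fun n => ((x / a)^-1) ^+ n)).
    + apply: nearW => n; rewrite expR_ge0/= expRN exprVn.
      have p : 0 < (x / a) ^+ n by rewrite exprn_gt0// (lt_trans ltr01).
      rewrite lef_pV2 ?posrE ?expR_gt0//.
      by rewrite (le_trans _ (expR_ge1Dx _))// lerDr.
    + exact: cvg_cst.
    + apply: cvg_expr; rewrite ger0_norm ?invr_ge0// invf_lt1//.
      exact: lt_trans q1.
  rewrite -[X in _ --> X]subr0; apply: cvgB e; exact: cvg_cst.
- rewrite divff ?gt_eqF//; under eq_fun do rewrite expr1n; exact: cvg_cst.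
Qed.

(* Expanding [1 - expR (- (g t / a) ^+ n)] in powers of [g t ^+ n] bounds its
   integral against [f] by a multiple of [expR ((s / a) ^+ n) - 1], which tends
   to 0. *)
Lemma step_avg_moment (f : R -> R[i]) (a s C : R) :
  cintegrable E f -> 0 <= s < a ->
  (forall n, cmod (cintegral E (fun t => (g t)%:C ^+ n * f t)) <= C * s ^+ n) ->
  cmeasurable E (fun t => (step_avg a (g t))%:C) /\
  cintegral E (fun t => (step_avg a (g t))%:C * f t) = 0.
Proof.
move=> fi /andP[s0 sa] fC; have a0 : 0 < a by exact: le_lt_trans sa.
have C0 : 0 <= C by have := fC 0%N; rewrite expr0 mulr1; apply: le_trans (cmod_ge0 _).
(* Taylor coefficients of 1 - exp(-y) at y = (g/a)^n, written for powers of g^n; the sum has no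
   constant term. *)
pose c n j : R := - ((- (a^-1 ^+ n)) ^+ j.+1 / j.+1`!%:R).
pose k n m t : R[i] := \sum_(j < m) (c n j)%:C * ((g t)%:C ^+ n) ^+ j.+1.
pose phi n t : R := 1 - expR (- (g t / a) ^+ n).
have kE n m t : k n m t = (- (\sum_(j < m) (- (g t / a) ^+ n) ^+ j.+1 / j.+1`!%:R))%:C.
  rewrite -sumrN rmorph_sum/=; apply: eq_bigr => j _.
  rewrite -!rmorphXn -rmorphM /=; congr (_%:C); rewrite /c.
  have -> : - (g t / a) ^+ n = - (a^-1 ^+ n) * g t ^+ n.
    by rewrite exprMn mulrC mulNr.
  by rewrite exprMn mulNr mulrAC.
have mk n m : cmeasurable E (k n m).
  apply: (@cmeasurable_sum _ _ (fun j t => (c n j)%:C * ((g t)%:C ^+ n) ^+ j.+1)) => j.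
  apply: cmeasurableM; first exact: cmeasurable_cst.
  by do 2 apply: cmeasurableX; exact: cmeasurable_real.
have kphi n t : k n ^~ t @ \oo --> (phi n t)%:C.
  apply/cvg_complexP; split => /=; last first.
    under eq_fun do rewrite kE/=; exact: cvg_cst.
  under eq_fun do rewrite kE/=.
  rewrite /phi -opprB; apply: cvgN; exact: exp_tail_cvg.
have mphi n : cmeasurable E (fun t => (phi n t)%:C).
  by apply: (@cmeasurable_cvg _ _ (k n) _ mE (mk n)) => t _.
have phistep t : E t -> (fun n => (phi n t)%:C) @ \oo --> (step_avg a (g t))%:C.
  move=> /g01/andP[g0 _]; apply/cvg_complexP; split => /=; last exact: cvg_cst.
  exact: step_avg_cvg.
have mstep : cmeasurable E (fun t => (step_avg a (g t))%:C).
  exact: (@cmeasurable_cvg _ _ (fun n t => (phi n t)%:C) _ mE mphi).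
split => //.
have phi1 n t : E t -> cmod (phi n t)%:C <= 1.
  move=> /g01/andP[g0 _]; rewrite cmod_real /phi ger0_norm.
    by rewrite lerBlDr lerDl expR_ge0.
  by rewrite subr_ge0 -(@expR0 R) ler_expR oppr_le0 exprn_ge0// divr_ge0// ltW.
have lim := @cintegral_dominated_cvg _ _ (fun n t => (phi n t)%:C) _ f 1 mE mphi
  phi1 phistep fi.
apply: cvg_unique_complex lim _.
apply: (@cvg_cmod _ _ _ (fun n => 2 * (C * (expR ((s / a) ^+ n) - 1)))); last first.
  have c0 : (fun n => (s / a) ^+ n) @ \oo --> (0 : R).
    by apply: cvg_expr; rewrite ger0_norm ?divr_ge0 ?(ltW a0)// ltr_pdivrMr// mul1r.
  have e : (fun n => expR ((s / a) ^+ n)) @ \oo --> expR 0.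
    exact: (cvg_comp _ _ c0 (@continuous_expR R 0)).
  rewrite -[X in _ --> X](mulr0 2); apply: cvgMr.
  rewrite -[X in _ --> X](mulr0 C); apply: cvgMr.
  rewrite -(subrr 1) -[X in _ --> X - _](@expR0 R); apply: cvgB e _; exact: cvg_cst.
move=> n; rewrite subr0.
(* Since g <= 1, [K] bounds the Taylor sums for all m. It depends on n, but the limit in m is taken
   with n fixed. *)
pose K := expR (a^-1 ^+ n) - 1.
have kK m t : E t -> cmod (k n m t) <= K.
  move=> /g01/andP[g0 g1]; rewrite (le_trans (ler_cmod_sum _ _ _))//.
  rewrite /K (le_trans _ (exp_tail_le m _))// ?exprn_ge0 ?invr_ge0 ?(ltW a0)//.
  apply: ler_sum => j _; rewrite cmodM !cmodX !cmod_real /c normrN normrM normrX normrN.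
  rewrite (ger0_norm (_ : 0 <= a^-1 ^+ n)) ?exprn_ge0 ?invr_ge0 ?(ltW a0)//.
  rewrite normfV normr_nat ler_piMr//.
    by rewrite divr_ge0// !exprn_ge0 ?invr_ge0 ?(ltW a0).
  by rewrite !exprn_ile1 ?exprn_ge0// ger0_norm.
have lim' := @cintegral_dominated_cvg _ _ (k n) (fun t => (phi n t)%:C) f K mE
  (mk n) kK (fun t _ => kphi n t) fi.
apply: (cmod_lim_le lim') => m.
have -> : cintegral E (fun t => k n m t * f t) =
    \sum_(j < m) (c n j)%:C * cintegral E (fun t => (g t)%:C ^+ (n * j.+1) * f t).
  have -> : cintegral E (fun t => k n m t * f t) = cintegral E
      (fun t => \sum_(j < m) (c n j)%:C * ((g t)%:C ^+ (n * j.+1) * f t)).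
    apply: eq_cintegral => t _; rewrite /k mulr_suml; apply: eq_bigr => j _.
    by rewrite mulrA exprM.
  have gi j : cintegrable E (fun t => (g t)%:C ^+ (n * j.+1) * f t).
    apply: (@cintegrableM _ _ _ _ 1 mE) => //.
      by apply: cmeasurableX; exact: cmeasurable_real.
    by move=> t /g01/andP[g0 g1]; rewrite cmodX cmod_real ger0_norm// exprn_ile1.
  rewrite (cintegral_sum m mE (fun j => cintegrableZ (c n j)%:C mE (gi j))).2.
  by apply: eq_bigr => j _; rewrite cintegralZ.
rewrite (le_trans (ler_cmod_sum _ _ _))//.
apply: (@le_trans _ _ (C * \sum_(j < m) ((s / a) ^+ n) ^+ j.+1 / j.+1`!%:R)); last first.
  by rewrite ler_wpM2l// exp_tail_le// exprn_ge0// divr_ge0// ltW.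
rewrite mulr_sumr; apply: ler_sum => j _.
rewrite cmodM cmod_real /c normrN normrM normrX normrN.
rewrite (ger0_norm (_ : 0 <= a^-1 ^+ n)) ?exprn_ge0 ?invr_ge0 ?(ltW a0)//.
rewrite normfV normr_nat.
rewrite (_ : C * _ = (a^-1 ^+ n) ^+ j.+1 / j.+1`!%:R * (C * s ^+ (n * j.+1))).
  rewrite ler_wpM2l ?fC// divr_ge0// !exprn_ge0// invr_ge0 ltW//.
rewrite exprM !exprMn; ring.
Qed.

(** [step_avg_moment] applies to g^m f for every level a > s. As a decreases to s the averaged steps
    tend to the indicator of g > s, whose integral against g^m f is therefore 0. *)
Lemma cintegral_power_cut (f : R -> R[i]) (s : R) m :
  cintegrable E f -> 0 <= s ->
  (forall a, s < a -> exists C, forall n,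
     cmod (cintegral E (fun t => (g t)%:C ^+ n * f t)) <= C * a ^+ n) ->
  cintegral E (fun t => (g t)%:C ^+ m * f t) =
  cintegral (E `&` [set t | g t <= s]) (fun t => (g t)%:C ^+ m * f t).
Proof.
move=> fi s0 fC; pose h t := (g t)%:C ^+ m * f t.
have hi : cintegrable E h.
  apply: (@cintegrableM _ _ _ _ 1 mE) => //.
    by apply: cmeasurableX; exact: cmeasurable_real.
  by move=> t /g01/andP[g0 g1]; rewrite cmodX cmod_real ger0_norm// exprn_ile1.
have step0 a : s < a -> cmeasurable E (fun t => (step_avg a (g t))%:C) /\
    cintegral E (fun t => (step_avg a (g t))%:C * h t) = 0.
  (* The decay rate must be strictly below the level a, hence the midpoint. Multiplying f by g^m
     shifts the moments by m, which only changes the constant. *)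
  move=> sa; have [C HC] := fC ((s + a) / 2) (midf_lt sa).1.
  apply: (@step_avg_moment h a ((s + a) / 2) (C * ((s + a) / 2) ^+ m)) => //.
    by rewrite (midf_lt sa).2 andbT divr_ge0// addr_ge0// (le_trans s0)// ltW.
  move=> n; rewrite -mulrA -exprD addnC (le_trans _ (HC _))//.
  rewrite le_eqVlt; apply/orP; left; apply/eqP; congr cmod.
  by apply: eq_cintegral => t _; rewrite /h mulrA exprD.
pose a_ (k : nat) : R := s + k.+1%:R^-1.
have sa k : s < a_ k by rewrite ltrDl invr_gt0.
have a_s : a_ @ \oo --> s.
  rewrite -[X in _ --> X]addr0; apply: cvgD; [exact: cvg_cst|exact: cvg_harmonic].
pose chi t : R[i] := if s < g t then 1 else 0.
(* Where g t <= s the steps vanish for every k, as a_k > s; where g t > s they are eventually 1. The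
   exceptional value at equality does not survive in the limit. *)
have chi_lim t : E t -> (fun k => (step_avg (a_ k) (g t))%:C) @ \oo --> chi t.
  move=> Et; rewrite /chi; case: ltP => [sg|gs]; last first.
    rewrite (_ : (fun k => _) = (fun=> 0)); first exact: cvg_cst.
    by apply/funext => k; rewrite /step_avg (le_lt_trans gs).
  have [N _ HN] : \forall k \near \oo, a_ k < g t by apply: (cvgr_lt _ a_s).
  apply: cvg_near_cst.
  exists N => // k /HN ag; rewrite /step_avg ltNge (ltW ag)/= gt_eqF//.
have mchi : cmeasurable E chi.
  by apply: (cmeasurable_cvg mE (fun k => (step0 _ (sa k)).1)).
have step1 k t : E t -> cmod (step_avg (a_ k) (g t))%:C <= 1.
  move=> _; rewrite cmod_real /step_avg; case: ifP => _; first by rewrite normr0.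
  case: ifP => _; last by rewrite normr1.
  by rewrite ger0_norm ?subr_ge0 ?expR_le1 ?oppr_le0// lerBlDr lerDl expR_ge0.
have chi0 : cintegral E (fun t => chi t * h t) = 0.
  have lim := @cintegral_dominated_cvg _ _ (fun k t => (step_avg (a_ k) (g t))%:C)
    chi h 1 mE (fun k => (step0 _ (sa k)).1) step1 chi_lim hi.
  apply: cvg_unique_complex lim _.
  rewrite (_ : (fun k => _) = (fun=> 0)); first exact: cvg_cst.
  by apply/funext => k; exact: (step0 _ (sa k)).2.
have chi1 t : E t -> cmod (chi t) <= 1.
  by move=> _; rewrite /chi; case: ifP => _; rewrite ?cmod1// cmod0.
have chihi := cintegrableM mE mchi chi1 hi.
pose E1 := E `&` [set t | g t <= s]; pose E2 := E `&` [set t | s < g t].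
have mE1 : measurable E1.
  rewrite (_ : E1 = E `&` g @^-1` `]-oo, s]); first exact: mg.
  by apply/seteqP; split => t /=; rewrite in_itv.
have mE2 : measurable E2.
  rewrite (_ : E2 = E `&` g @^-1` `]s, +oo[); first exact: mg.
  by apply/seteqP; split => t /=; rewrite in_itv/= andbT.
have E12 : E = E1 `|` E2.
  rewrite -setIUr (_ : _ `|` _ = setT) ?setIT//.
  by apply/seteqP; split => t //= _; case: (leP (g t) s); [left|right].
have dis : [disjoint E1 & E2].
  apply/disj_setPS => t [[_ /=]] + [_ /=].
  by rewrite leNgt => /negP.
have split_int k : cintegrable E k ->
    cintegral E k = cintegral E1 k + cintegral E2 k.
  by rewrite {1 2}E12 => ki; rewrite cintegral_setU.
have h2 : cintegral E2 h = 0.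
  rewrite -chi0 (split_int _ chihi) (_ : cintegral E1 _ = 0) ?add0r.
    apply: eq_cintegral => t [_ /= sg]; by rewrite /chi sg mul1r.
  rewrite -(cintegral0 E1); apply: eq_cintegral => t [_ /=].
  by rewrite leNgt /chi => /negbTE ->; rewrite mul0r.
by rewrite -/h (split_int _ hi) h2 addr0.
Qed.

(* The hypothesis on [l] keeps the binomial coefficients from vanishing; they
   then decay subexponentially, so convergence forces the moments to decay
   like [(cmod u)^-n]. *)
Lemma moment_bound (A : nat -> R[i]) (l u S : R[i]) (a : R) :
  (forall n : nat, l != - n%:R) -> u != 0 -> (cmod u)^-1 < a ->
  (fun N => \sum_(n < N) bcoef l n * u ^+ n * A n) @ \oo --> S ->
  exists C, forall n, cmod (A n) <= C * a ^+ n.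
Proof.
move=> ln u0 ua AS.
have u0' : 0 < cmod u by rewrite cmod_gt0.
have a0 : 0 < a by rewrite (lt_trans _ ua)// invr_gt0.
have [M M0 HM] := cvg_bounded_complex AS.
(* Each term is the difference of two partial sums, and convergent partial sums are bounded. *)
have term n : cmod (bcoef l n * u ^+ n * A n) <= M + M.
  have -> : bcoef l n * u ^+ n * A n = \sum_(n < n.+1) bcoef l n * u ^+ n * A n -
      \sum_(n < n) bcoef l n * u ^+ n * A n by rewrite big_ord_recr/= addrAC subrr add0r.
  by rewrite (le_trans (ler_cmodB _ _))// lerD.
(* This q is less than 1 exactly because a exceeds 1/|u|. *)
have [|C C0 HC] := subexp_bcoefV ln (q := (cmod u * a)^-1).
  rewrite invr_gt0 mulr_gt0//= invf_lt1 ?mulr_gt0//.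
  by rewrite mulrC -ltr_pdivrMr// mul1r.
exists ((M + M) * C) => n.
have b0 : 0 < cmod (bcoef l n).
  rewrite cmod_gt0; apply: mulf_neq0; first exact: poch_neq0.
  by rewrite invr_neq0// pnatr_eq0 -lt0n fact_gt0.
rewrite -ler_pdivrMr ?exprn_gt0//.
have -> : cmod (A n) / a ^+ n = cmod (bcoef l n * u ^+ n * A n) *
    ((cmod (bcoef l n))^-1 * (cmod u * a)^-1 ^+ n).
  have [b1 u1 a1] := And3 (lt0r_neq0 b0) (lt0r_neq0 u0') (lt0r_neq0 a0).
  rewrite cmodM [cmod (_ * _ ^+ _)]cmodM cmodX exprVn exprMn.
  by field; rewrite b1 !expf_neq0.
apply: ler_pM => //; first exact: cmod_ge0.
by rewrite mulr_ge0 ?invr_ge0 ?cmod_ge0 ?exprn_ge0// invr_ge0 mulr_ge0 ?cmod_ge0// ltW.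
Qed.

End moments.

(** * Transfer of moments *)

(** Only exp(log v) = v is used, so the cut is no obstacle. *)
Lemma cpow_nat (R : realType) (v : R[i]) k : v != 0 -> cpow v k%:R = v ^+ k.
Proof.
move=> v0; elim: k => [|k IH]; first by rewrite /cpow mul0r cexp0 expr0.
by rewrite /cpow -natr1 mulrDl mul1r cexpD -/(cpow _ _) IH cexp_clog// -exprSr.
Qed.

Lemma bcoef_negnat (R : realType) k n :
  bcoef (- k%:R : R[i]) n = (-1) ^+ n * 'C(k, n)%:R.
Proof.
elim: n => [|n IH]; first by rewrite bcoef0 bin0 expr0 mulr1.
have n0 : n.+1%:R != 0 :> R[i] by rewrite pnatr_eq0.
apply: (mulIf n0); rewrite bcoefS IH exprS -[RHS]mulrA -natrM.
rewrite -[('C(k, n.+1) * n.+1)%N]mulnC mul_bin_left natrM.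
(* Truncated subtraction agrees with the ring for n < k. At n = k the factor is 0, and beyond it the
   binomial coefficient is. *)
have [kn|kn] := leqP k n; last by rewrite natrB ?(ltnW kn)//; ring.
move: kn; rewrite leq_eqVlt => /predU1P[->|kn]; last by rewrite bin_small//; ring.
by rewrite subnn; ring.
Qed.

Lemma binomial_negnat (R : realType) k (x : R[i]) N : (k < N)%N ->
  \sum_(n < N) bcoef (- k%:R) n * x ^+ n = (1 - x) ^+ k.
Proof.
move=> kN; rewrite exprBn -(subnK kN) addnC big_split_ord/= [X in _ + X]big1 ?addr0.
  by apply: eq_bigr => i _; rewrite bcoef_negnat expr1n -[RHS]mulr_natr [_ * 1]mulr1 mulrAC.
by move=> i _; rewrite bcoef_negnat bin_small ?mulr0 ?mul0r// ltn_addr.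
Qed.

Section moment_transfer.
Variable R : realType.
Variables (f : R -> R[i]) (g : R -> R).

Lemma cintegrable_powerM (E : set (measurableTypeR R)) (h : R -> R) n m :
  measurable E -> cintegrable E f -> measurable_fun E g -> measurable_fun E h ->
  (forall t, E t -> 0 <= g t <= 1) -> (forall t, E t -> 0 <= h t <= 1) ->
  cintegrable E (fun t => (g t)%:C ^+ n * (h t)%:C ^+ m * f t).
Proof.
move=> mE fi mg mh g01 h01; apply: (@cintegrableM _ _ _ _ 1 mE) => //.
  by apply: cmeasurableM; apply: cmeasurableX; exact: cmeasurable_real.
move=> t Et; have [/andP[g0 g1] /andP[h0 h1]] := conj (g01 t Et) (h01 t Et).
rewrite cmodM !cmodX !cmod_real !ger0_norm//.
by rewrite mulr_ile1 ?exprn_ge0 ?exprn_ile1.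
Qed.

(** Powers of 1 - g are polynomials in g, so equal moments of g give equal moments of 1 - g. This
    carries a restriction of the domain found with one series over to the other series. *)
Lemma moment_complement (E E' : set (measurableTypeR R)) :
  measurable E -> measurable E' -> E' `<=` E -> cintegrable E f ->
  measurable_fun E g -> (forall t, E t -> 0 <= g t <= 1) ->
  (forall m, cintegral E (fun t => (g t)%:C ^+ m * f t) =
             cintegral E' (fun t => (g t)%:C ^+ m * f t)) ->
  forall m, cintegral E (fun t => (1 - g t)%:C ^+ m * f t) =
            cintegral E' (fun t => (1 - g t)%:C ^+ m * f t).
Proof.
move=> mE mE' EE' fi mg g01 H.
have mh : measurable_fun E (fun t => 1 - g t) by exact: measurable_funB.
have h01 t : E t -> 0 <= 1 - g t <= 1.
  by move=> /g01/andP[g0 g1]; rewrite subr_ge0 g1 lerBlDr lerDl.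
have int n m := @cintegrable_powerM E (fun t => 1 - g t) n m mE fi mg mh g01 h01.
have int' n m := cintegrableS mE mE' EE' (int n m).
(* Mixed moments make the induction close: (1 - g)^(m+1) is (1 - g)^m minus g (1 - g)^m, which
   raises the exponent of g. *)
suff K m n : cintegral E (fun t => (g t)%:C ^+ n * (1 - g t)%:C ^+ m * f t) =
             cintegral E' (fun t => (g t)%:C ^+ n * (1 - g t)%:C ^+ m * f t).
  move=> m; have := K m 0%N.
  by under eq_cintegral do rewrite mul1r; under [RHS]eq_cintegral do rewrite mul1r.
elim: m n => [|m IH] n.
  rewrite (@eq_cintegral _ _ _ (fun t => (g t)%:C ^+ n * f t)); last by move=> t _; rewrite mulr1.
  by rewrite H; apply: eq_cintegral => t _; rewrite mulr1.
have S (D : set (measurableTypeR R)) : measurable D ->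
    (forall n m, cintegrable D (fun t => (g t)%:C ^+ n * (1 - g t)%:C ^+ m * f t)) ->
    cintegral D (fun t => (g t)%:C ^+ n * (1 - g t)%:C ^+ m.+1 * f t) =
    cintegral D (fun t => (g t)%:C ^+ n * (1 - g t)%:C ^+ m * f t) -
    cintegral D (fun t => (g t)%:C ^+ n.+1 * (1 - g t)%:C ^+ m * f t).
  move=> mD Di; rewrite -[X in _ - X]mul1r -mulNr -cintegralZ// -cintegralD//.
    apply: eq_cintegral => t _; rewrite !exprS rmorphB/= rmorph1; ring.
  exact: cintegrableZ.
by rewrite S// S// !IH.
Qed.

(** [moment_bound] provides the decay that [cintegral_power_cut] requires at s = 1/|u|; for u = 0
    the cut is vacuous. *)
Lemma moment_cut (E : set (measurableTypeR R)) (l u S : R[i]) :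
  measurable E -> cintegrable E f ->
  measurable_fun E g -> (forall t, E t -> 0 <= g t <= 1) ->
  (forall n : nat, l != - n%:R) ->
  (fun N => \sum_(n < N) bcoef l n * u ^+ n *
     cintegral E (fun t => (g t)%:C ^+ n * f t)) @ \oo --> S ->
  forall m, cintegral E (fun t => (g t)%:C ^+ m * f t) =
     cintegral (E `&` [set t | cmod u * g t <= 1]) (fun t => (g t)%:C ^+ m * f t).
Proof.
move=> mE fi mg g01 ln AS m.
have [->|u0] := eqVneq u 0.
  rewrite (_ : E `&` _ = E)//; apply/seteqP; split => t; first by case.
  by move=> Et; split => //=; rewrite cmod0 mul0r.
have u0' : 0 < cmod u by rewrite cmod_gt0.
rewrite (_ : [set t | cmod u * g t <= 1] = [set t | g t <= (cmod u)^-1]).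
  apply: cintegral_power_cut => //; first by rewrite invr_ge0 ltW.
  by move=> a ua; exact: (moment_bound ln u0 ua AS).
by apply/seteqP; split => t /=; rewrite -ler_pdivlMl// mulr1.
Qed.

End moment_transfer.

(** * Pfaff's identity for moments *)

Section pfaff.
Variables (R : realType) (f : R -> R[i]) (l z S S' : R[i]).
Let D : set (measurableTypeR R) := `]0, 1[%classic.
Let w := z / (z - 1).
Hypotheses (fi : cintegrable D f) (z1 : z != 1).
Hypothesis cvS : (fun N => \sum_(n < N) bcoef l n * z ^+ n *
  cintegral D (fun t => t%:C ^+ n * f t)) @ \oo --> S.
Hypothesis cvS' : (fun N => \sum_(n < N) bcoef l n * w ^+ n *
  cintegral D (fun t => (1 - t)%:C ^+ n * f t)) @ \oo --> S'.

Let mD : measurable D. Proof. exact: measurable_itv. Qed.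

Let mid (E : set (measurableTypeR R)) : measurable_fun E (fun t : R => t).
Proof. exact: measurable_id. Qed.

Let monem (E : set (measurableTypeR R)) : measurable_fun E (fun t : R => 1 - t).
Proof. by apply: measurable_funB => //; exact: measurable_id. Qed.

Let D01 t : D t -> 0 <= t <= 1.
Proof. by rewrite /D /= in_itv/= => /andP[/ltW -> /ltW ->]. Qed.

Let D01' t : D t -> 0 <= 1 - t <= 1.
Proof. by move=> /D01/andP[t0 t1]; rewrite subr_ge0 t1 lerBlDr lerDl. Qed.

Let z1' : 1 - z != 0. Proof. by rewrite subr_eq0 eq_sym. Qed.

Let vw (t : R) : (1 - z) * (1 - (1 - t)%:C * w) = 1 - t%:C * z.
Proof.
rewrite /w rmorphB/= rmorph1; move: (t%:C) => t'; field.
by rewrite subr_eq0.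
Qed.

(** Both series terminate and equal integrals of k-th powers, so the claim is the k-th power of [vw]
    under the integral sign. The exponent - l is then the natural number k, for which the principal
    power is an ordinary one, even on the cut. *)
Lemma pfaff_moments_polynomial k : l = - k%:R -> S = cpow (1 - z) (- l) * S'.
Proof.
move=> lk.
have H (g : R -> R) (u T : R[i]) : measurable_fun D g ->
    (forall t, D t -> 0 <= g t <= 1) ->
    (fun N => \sum_(n < N) bcoef l n * u ^+ n *
      cintegral D (fun t => (g t)%:C ^+ n * f t)) @ \oo --> T ->
    cintegrable D (fun t => (1 - (g t)%:C * u) ^+ k * f t) /\
    T = cintegral D (fun t => (1 - (g t)%:C * u) ^+ k * f t).
  move=> mg g01 cvT.
  have sumE N : (k < N)%N -> \sum_(n < N) bcoef l n * u ^+ n *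
      cintegral D (fun t => (g t)%:C ^+ n * f t) =
      cintegral D (fun t => (1 - (g t)%:C * u) ^+ k * f t).
    move=> kN; rewrite -(cintegral_power_sum mD fi mg g01 (fun n => bcoef l n * u ^+ n)).
    apply: eq_cintegral => t _; congr (_ * _).
    rewrite lk -(@binomial_negnat _ _ _ N)//; apply: eq_bigr => i _.
    by rewrite exprMn mulrCA mulrC mulrA.
  split; last first.
    apply: (cvg_unique_complex cvT); apply: cvg_near_cst.
    by exists k.+1 => // N /= kN; exact: sumE.
  apply: (@cintegrableM _ _ _ _ ((1 + cmod u) ^+ k) mD) => //.
    apply: cmeasurableX; split.
      under eq_fun do rewrite Re_add Re_opp Re_mul/= mul0r subr0.
      by apply: measurable_funB => //; apply: measurable_funM.
    under eq_fun do rewrite Im_add Im_opp Im_mul/= mul0r addr0.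
    by apply: measurable_funB => //; apply: measurable_funM.
  move=> t Dt; rewrite cmodX lerXn2r ?nnegrE ?cmod_ge0 ?addr_ge0 ?cmod_ge0//.
  rewrite (le_trans (ler_cmodB _ _))// cmod1 lerD2l cmodM cmod_real.
  by have /andP[g0 g1] := g01 t Dt; rewrite ger0_norm// ler_piMl ?cmod_ge0.
have [_ ->] := H _ _ _ (@mid D) D01 cvS.
have [i ->] := H _ _ _ (@monem D) D01' cvS'.
rewrite lk opprK cpow_nat// -cintegralZ//; apply: eq_cintegral => t _.
by rewrite mulrA -exprMn vw.
Qed.

Lemma pfaff_moments : S = cpow (1 - z) (- l) * S'.
Proof.
have [/existsNP[k /negP/negPn/eqP lk]|/contrapT ln] :=
  pselect (~ forall n : nat, l != - n%:R); first exact: pfaff_moments_polynomial lk.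
pose E := D `&` [set t | cmod z * t <= 1].
pose E' := E `&` [set t | cmod w * (1 - t) <= 1].
have mle (F : set (measurableTypeR R)) (g : R -> R) c :
    measurable F -> measurable_fun F g -> measurable (F `&` [set t | c * g t <= 1]).
  move=> mF mg.
  have -> : F `&` [set t | c * g t <= 1] = F `&` (fun t => c * g t) @^-1` `]-oo, 1].
    by apply/seteqP; split => t /=; rewrite in_itv.
  by apply: measurable_funM mF _ _ => //; exact: measurable_cst.
have mE : measurable E by exact: mle.
have mE' : measurable E' by exact: (mle E (fun t => 1 - t)).
have ED : E `<=` D by exact: subIsetl.
have E'E : E' `<=` E by exact: subIsetl.
have fE := cintegrableS mD mE ED fi.
have fE' := cintegrableS mE mE' E'E fE.
have E01 t : E t -> 0 <= t <= 1 by move=> /ED/D01.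
have E01' t : E t -> 0 <= 1 - t <= 1 by move=> /ED/D01'.
have momDE := moment_cut mD fi (@mid D) D01 ln cvS.
(* The second series is in powers of 1 - t, so the first cut has to be transferred to those moments
   before the second cut is made. *)
have momDE' := moment_complement mD mE ED fi (@mid D) D01 momDE.
have transfer (u T : R[i]) (A B : nat -> R[i]) : A =1 B ->
    (fun N => \sum_(n < N) bcoef l n * u ^+ n * A n) @ \oo --> T ->
    (fun N => \sum_(n < N) bcoef l n * u ^+ n * B n) @ \oo --> T.
  by move=> /funext ->.
have cvE' := transfer _ _ _ _ momDE' cvS'.
have momEE' := moment_cut mE fE (@monem E) E01' ln cvE'.
have momEE := moment_complement mE mE' E'E fE (@monem E) E01' momEE'.
(* [momEE] concerns the complement of 1 - t, that is t itself; combined with [momDE] it brings the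
   first series to the same domain [E'] as the second. *)
have momDE2 n : cintegral D (fun t => t%:C ^+ n * f t) =
    cintegral E' (fun t => t%:C ^+ n * f t).
  have subK F : cintegral F (fun t => (1 - (1 - t))%:C ^+ n * f t) =
      cintegral F (fun t => t%:C ^+ n * f t).
    by apply: eq_cintegral => t _; rewrite subKr.
  exact: etrans (momDE n) (etrans (esym (subK E)) (etrans (momEE n) (subK E'))).
have cv2 := transfer _ _ _ _ momDE2 cvS.
have cv2' := transfer _ _ _ _ momEE' cvE'.
have [zs|zs] := boolP (slit (1 - z)).
  have [_ ->] := abel_binomial_integral mE' fE' (@mid E') (fun t h => E01 t (E'E t h))
    zs (fun t h => (E'E t h).2) cv2.
  have ws : slit (1 - w).
    have -> : 1 - w = (1 - z)^-1.
      by rewrite /w; field; rewrite z1' subr_eq0.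
    exact: slit_inv.
  have [i ->] := abel_binomial_integral mE' fE' (@monem E') (fun t h => E01' t (E'E t h))
    ws (fun t h => h.2) cv2'.
  rewrite -cintegralZ//; apply: eq_cintegral => t /E'E/E01 t01.
  by rewrite mulrA /cpow -cexpD -mulrDr -clog_pfaff.
(* here z is real and z > 1, so that E' contains at most the point 1 / z *)
have [x x1 zx] : exists2 x : R, 1 < x & z = x%:C.
  move: zs; rewrite /slit negb_or negbK Re_add Im_add Re_opp Im_opp/= sub0r oppr_eq0.
  rewrite -leNgt subr_le0 => /andP[/eqP zi zr]; exists (Re z); last exact: complexP.
  rewrite lt_neqAle zr andbT; apply: contra_neq z1 => e.
  by apply: complexP; rewrite -?e ?zi.
have E'1 : E' `<=` [set x^-1].
  have x0 : 0 < x by exact: lt_trans x1.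
  have wx : w = (x / (x - 1))%:C by rewrite /w zx fmorph_div rmorphB rmorph1.
  (* The constraint x t <= 1 bounds t above by 1/x, and x (1 - t) <= x - 1 bounds it below by
     1/x. *)
  move=> t [[_ /=]]; rewrite wx zx !cmod_real.
  have y0 : 0 < x - 1 by rewrite subr_gt0.
  rewrite (ger0_norm (divr_ge0 (ltW x0) (ltW y0))) (ger0_norm (ltW x0)) => h1.
  rewrite mulrAC ler_pdivrMr// mul1r => h2.
  apply: (mulfI (lt0r_neq0 x0)); rewrite divff ?gt_eqF//; lra.
have E'0 F : cintegral E' F = 0.
  by case: (subset_set1 E'1) => ->; apply: complexP => /=;
    rewrite ?Rintegral_set0 ?Rintegral_set1.
(* All moments over the null set [E'] vanish, so both sums are 0 and the claim is independent of the
   branch of the power at 1 - z. *)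
have T0 (c : nat -> R[i]) (k : nat -> R -> R[i]) (T : R[i]) :
    (fun N => \sum_(n < N) c n * cintegral E' (k n)) @ \oo --> T -> T = 0.
  move=> /cvg_unique_complex; apply; rewrite (_ : (fun N => _) = (fun=> 0)).
    exact: cvg_cst.
  by apply/funext => N; rewrite big1// => n _; rewrite E'0 mulr0.
rewrite (T0 (fun n => bcoef l n * w ^+ n) (fun n t => (1 - t)%:C ^+ n * f t) S' cv2').
rewrite mulr0.
exact: (T0 (fun n => bcoef l n * z ^+ n) (fun n t => t%:C ^+ n * f t) S cv2).
Qed.

End pfaff.

(** * The reflection t -> 1 - t *)

(** By uniqueness it suffices to compare half-open intervals; the reflection moves the closed end to
    the other side and keeps the length. *)
Lemma lebesgue_measure_onem (R : realType) (A : set (measurableTypeR R)) :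
  measurable A ->
  pushforward (@lebesgue_measure R) (fun t : measurableTypeR R => 1 - t : measurableTypeR R) A =
  lebesgue_measure A.
Proof.
have mphi : measurable_fun setT (fun t : measurableTypeR R => 1 - t : measurableTypeR R).
  by apply: measurable_funB => //; exact: measurable_id.
move=> mA; apply/esym/lebesgue_measure_unique => //= _ [[a b]] _ <-.
rewrite /pushforward (_ : _ @^-1` _ = `[1 - b, 1 - a[%classic); last first.
  apply/seteqP; split => x /=; rewrite !in_itv/= => /andP[h1 h2];
    by apply/andP; split; lra.
rewrite !lebesgue_measure_itv/= !lte_fin ltrD2l ltrN2.
by case: ifPn => // _; rewrite -!EFinB; congr (_%:E); ring.
Qed.

Section onem.
Variable R : realType.
Local Notation mu := (@lebesgue_measure R).
Let D : set (measurableTypeR R) := `]0, 1[%classic.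
Let phi (t : measurableTypeR R) : measurableTypeR R := 1 - t.

Let mphi : measurable_fun setT phi.
Proof. by apply: measurable_funB => //; exact: measurable_id. Qed.

Let mD : measurable D. Proof. exact: measurable_itv. Qed.

Let phiD : phi @^-1` D = D.
Proof.
by apply/seteqP; split => x; rewrite /D /phi /= !in_itv/= => /andP[h1 h2];
  apply/andP; split; lra.
Qed.

(** The change of variables along the pushforward is made for nonnegative functions, hence on the
    positive and negative parts of h separately. *)
Lemma Rintegral_onem (h : R -> R) : measurable_fun D h ->
  Rintegral mu D h = Rintegral mu D (fun t => h (1 - t)).
Proof.
move=> mh; rewrite /Rintegral; congr fine.
have mh' : measurable_fun D (fun x => (h x)%:E) by exact/measurable_EFinP.
have pos (k : R -> \bar R) : measurable_fun D k -> (forall x, 0 <= k x)%E ->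
    (\int[mu]_(x in D) k x = \int[mu]_(x in D) k (1 - x)%R)%E.
  move=> mk k0.
  have -> : (\int[mu]_(x in D) k x = \int[pushforward mu phi]_(x in D) k x)%E.
    apply: eq_measure_integral => A mA _; exact/esym/lebesgue_measure_onem.
  by rewrite (ge0_integral_pushforward mphi)// phiD.
rewrite [LHS]integralE [RHS]integralE; congr (_ - _)%E.
  have -> := pos _ (measurable_funepos mh') (@funepos_ge0 _ _ _).
  by apply: eq_integral => x _; rewrite !funeposE.
have -> := pos _ (measurable_funeneg mh') (@funeneg_ge0 _ _ _).
by apply: eq_integral => x _; rewrite !funenegE.
Qed.

Lemma cintegral_onem (f : R -> R[i]) : cmeasurable D f ->
  cintegral D f = cintegral D (fun t => f (1 - t)).
Proof.
move=> [m1 m2]; apply: complexP => /=.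
- exact: (@Rintegral_onem (fun t => Re (f t))).
- exact: (@Rintegral_onem (fun t => Im (f t))).
Qed.

End onem.

(** * Principal powers of positive reals and the symmetry of the beta function *)

Lemma clog_real (R : realType) (t : R) : 0 < t -> clog t%:C = (ln t)%:C.
Proof.
move=> t0; rewrite /clog /carg cmod_real /= lexx ger0_norm ?(ltW t0)//.
by rewrite divff ?acos1 ?gt_eqF.
Qed.

Lemma cpow_addn (R : realType) (v s : R[i]) n : v != 0 ->
  cpow v (s + n%:R) = v ^+ n * cpow v s.
Proof.
by move=> v0; rewrite /cpow mulrDl cexpD -!/(cpow _ _) cpow_nat// mulrC.
Qed.

Lemma cmeasurable_cpow (R : realType) (E : set (measurableTypeR R)) (g : R -> R)
    (s : R[i]) :
  measurable E -> measurable_fun E g -> (forall t, E t -> 0 < g t) ->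
  cmeasurable E (fun t => cpow (g t)%:C s).
Proof.
move=> mE mg g0.
have mln : measurable_fun E (fun t => ln (g t)) by exact: measurableT_comp mg.
have mexp : measurable_fun E (fun t => expR (Re s * ln (g t))).
  by apply: measurableT_comp => //; exact: measurable_funM.
have H (k : R -> R) : continuous k -> measurable_fun E (fun t => k (Im s * ln (g t))).
  move=> ck; apply: (measurableT_comp (f := k)).
    exact: continuous_measurable_fun.
  exact: measurable_funM.
split.
- apply: (@eq_measurable_fun _ _ _ _ _
    (fun t => expR (Re s * ln (g t)) * cos (Im s * ln (g t)))).
    move=> t; rewrite inE => /g0 gt0.
    rewrite /cpow clog_real// /cexp Re_mul/= Re_mul Im_mul/=.
    by rewrite !mulr0 mul0r !subr0 add0r.
  by apply: measurable_funM => //; apply: H; exact: continuous_cos.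
- apply: (@eq_measurable_fun _ _ _ _ _
    (fun t => expR (Re s * ln (g t)) * sin (Im s * ln (g t)))).
    move=> t; rewrite inE => /g0 gt0.
    rewrite /cpow clog_real// /cexp Im_mul/= Re_mul Im_mul/=.
    by rewrite !mulr0 mul0r subr0 add0r addr0.
  by apply: measurable_funM => //; apply: H; exact: continuous_sin.
Qed.

Lemma Beta_sym (R : realType) (x y : R[i]) : Beta x y = Beta y x.
Proof.
rewrite /Beta cintegral_onem.
  by apply: eq_cintegral => t _; rewrite subKr mulrC.
have mD : measurable (`]0, 1[%classic : set (measurableTypeR R)) by exact: measurable_itv.
apply: cmeasurableM; apply: cmeasurable_cpow => //.
- by move=> t /=; rewrite in_itv/= => /andP[].
- by apply: measurable_funB => //; exact: measurable_id.
- by move=> t /=; rewrite in_itv/= subr_gt0 => /andP[].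
Qed.

(** * Pfaff's transformation of the M-Gauss hypergeometric function *)

Theorem theorem4p11 (R : realType) (p q : nat)
    (kappa : 'I_p -> R[i]) (mu : 'I_q -> R[i])
    (alpha beta lambda1 lambda2 lambda3 rho z : R[i])
    (hkappa : forall (i : 'I_p) (n : nat), kappa i != - n%:R)
    (hmu : forall (j : 'I_q) (n : nat), mu j != - n%:R)
    (halpha : 0 < complex.Re alpha)
    (hlambda2 : 0 < complex.Re lambda2)
    (hlambda3 : complex.Re lambda2 < complex.Re lambda3)
    (hrho : 0 < complex.Re rho)
    (hz : z != 1)
    (hconvl : MGauss_converges kappa mu alpha beta
                lambda1 lambda2 lambda3 z rho)
    (hconvr : MGauss_converges kappa mu alpha beta
                lambda1 (lambda3 - lambda2) lambda3 (z / (z - 1)) rho) :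
  MGauss kappa mu alpha beta lambda1 lambda2 lambda3 z rho =
  cpow (1 - z) (- lambda1) *
  MGauss kappa mu alpha beta
    lambda1 (lambda3 - lambda2) lambda3 (z / (z - 1)) rho.
Proof.
pose D : set (measurableTypeR R) := `]0, 1[%classic.
have mD : measurable D by exact: measurable_itv.
pose b := Beta lambda2 (lambda3 - lambda2).
pose f := MBeta_integrand kappa mu alpha beta lambda2 (lambda3 - lambda2) rho.
have fi : cintegrable D f by have := (hconvl.1 0%N).2; rewrite addr0.
have subK : lambda3 - (lambda3 - lambda2) = lambda2 by rewrite subKr.
have D0 (t : R) : D t -> (t%:C != 0 :> R[i]) /\ ((1 - t)%:C != 0 :> R[i]).
  rewrite /D /= in_itv/= => /andP[t0 t1].
  by rewrite !fmorph_eq0 !gt_eqF ?subr_gt0.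
(* Adding n to the first exponent multiplies the integrand by t^n, so the modified beta values are
   moments of the single function f; the normalizing factor 1/b is attached to f. *)
have momL n : cintegral D (fun t => t%:C ^+ n * (b^-1 * f t)) =
    MBeta kappa mu alpha beta (lambda2 + n%:R) (lambda3 - lambda2) rho / b.
  transitivity (cintegral D (fun t => b^-1 *
    MBeta_integrand kappa mu alpha beta (lambda2 + n%:R) (lambda3 - lambda2) rho t)).
    apply: eq_cintegral => t /D0[t0 _]; rewrite /f /MBeta_integrand (addrAC lambda2 n%:R) cpow_addn//.
    by ring.
  exact: etrans (@cintegralZ R D _ b^-1 mD (hconvl.1 n).2) (mulrC _ _).
(* The reflection t -> 1 - t swaps the two exponents and fixes t (1 - t), hence the M-series; the
   second family thus consists of moments of the same f in powers of 1 - t. *)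
have momR n : cintegral D (fun t => (1 - t)%:C ^+ n * (b^-1 * f t)) =
    MBeta kappa mu alpha beta (lambda3 - lambda2 + n%:R)
      (lambda3 - (lambda3 - lambda2)) rho / b.
  have Fi := (hconvr.1 n).2.
  apply: etrans (etrans (@cintegralZ R D _ b^-1 mD Fi) (mulrC _ _)).
  rewrite (cintegral_onem (cintegrable_cmeasurable (cintegrableZ b^-1 mD Fi))).
  apply: eq_cintegral => t /D0[t0 t1]; rewrite /f /MBeta_integrand subK.
  by rewrite subKr (mulrC (1 - t)) (addrAC _ n%:R) cpow_addn//; ring.
have cvg_of (u l2 S : R[i]) (A : nat -> R[i]) :
    (forall n, A n = MBeta kappa mu alpha beta (l2 + n%:R) (lambda3 - l2) rho /
       Beta l2 (lambda3 - l2)) ->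
    series (MGauss_term kappa mu alpha beta lambda1 l2 lambda3 u rho) @ \oo --> S ->
    (fun N => \sum_(n < N) bcoef lambda1 n * u ^+ n * A n) @ \oo --> S.
  move=> AE; rewrite (_ : series _ = (fun N => \sum_(n < N) bcoef lambda1 n * u ^+ n * A n))//.
  apply/funext => N; rewrite /series/= big_mkord; apply: eq_bigr => n _.
  by rewrite AE /MGauss_term /bcoef; ring.
apply: (@pfaff_moments R (fun t => b^-1 * f t) lambda1 z _ _ _ hz).
- exact: cintegrableZ.
- exact: (cvg_of _ _ _ _ momL hconvl.2).
(* The right-hand function is normalized by the beta value with swapped arguments, which equals b by
   symmetry. *)
- have momR' n : cintegral D (fun t => (1 - t)%:C ^+ n * (b^-1 * f t)) =
      MBeta kappa mu alpha beta (lambda3 - lambda2 + n%:R)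
        (lambda3 - (lambda3 - lambda2)) rho /
      Beta (lambda3 - lambda2) (lambda3 - (lambda3 - lambda2)).
    by rewrite momR subK Beta_sym.
  exact: (cvg_of _ _ _ _ momR' hconvr.2).
Qed.
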